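(* Let $(n_k)_{k\ge1}$ be a lacunary sequence of positive integers. Then for any dynamical system, i.e. any measure-preserving transformation $\tau$ of a probability space $(X,m)$, any $p$ with $1<p<\infty$, and any $f\in L^p(X)$, the series $\sum_{k=1}^\infty\left(M_{n_{k+1}}f-M_{n_k}f\right)$ is unconditionally convergent in $L^p(X)$.
   Context: $M_nf=\frac1n\sum_{k=1}^nf\circ\tau^k$ is the usual ergodic average. A sequence $(n_k)$ is lacunary if there is $\lambda>1$ with $n_{k+1}/n_k\ge\lambda$ for all $k$. A series $\sum_{k=1}^\infty f_k$ in a Banach space is unconditionally convergent if $\sum_{k=1}^\infty f_{\pi(k)}$ converges in norm for every permutation $\pi$ of $\{1,2,3,\dots\}$. *)

(* Defs.v *)
From HB Require Import structures.
From mathcomp Require Import all_boot all_order all_algebra.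
From mathcomp Require Import all_classical all_reals all_analysis.

Set Implicit Arguments.
Unset Strict Implicit.
Unset Printing Implicit Defensive.

Import Order.TTheory GRing.Theory Num.Theory.
Import numFieldNormedType.Exports.

Local Open Scope classical_set_scope.
Local Open Scope ring_scope.

(* Sequences indexed by k >= 1 in the literature are indexed here by k >= 0:
   [n k] stands for n_{k+1}. *)

Definition lacunary (R : realType) (n : nat -> nat) : Prop :=
  exists2 lambda : R, 1 < lambda &
    forall k : nat, lambda <= (n k.+1)%:R / (n k)%:R.

Definition measure_preserving (d : measure_display) (T : measurableType d)
    (R : realType) (mu : probability T R) (tau : T -> T) : Prop :=
  measurable_fun [set: T] tau /\
  forall A : set T, measurable A -> mu (tau @^-1` A) = mu A.

Definition ergodic_average (T : Type) (R : realType) (tau : T -> T) (n : nat)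
    (f : T -> R) : T -> R :=
  fun x => n%:R^-1 * \sum_(1 <= k < n.+1) f (iter k tau x).

(* Elements of L^p are handled through representatives: [Lfun mu p] is the
   space of measurable functions with finite L^p-norm, and the notions below
   are invariant under almost everywhere equality. *)
Definition Lp_convergent (d : measure_display) (T : measurableType d)
    (R : realType) (mu : probability T R) (p : R) (s : nat -> T -> R) : Prop :=
  exists2 g : T -> R, g \in Lfun mu p%:E &
    (fun N : nat => Lnorm mu p%:E (EFin \o (s N - g))) @ \oo --> 0%E.

Definition Lp_unconditionally_convergent (d : measure_display)
    (T : measurableType d) (R : realType) (mu : probability T R) (p : R)
    (u : nat -> T -> R) : Prop :=
  (forall k : nat, u k \in Lfun mu p%:E) /\
  forall pi : nat -> nat, bijective pi ->
    Lp_convergent mu p (series (u \o pi)).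

(* Main.v *)
Require Import Defs.
From mathcomp Require Import all_boot all_order all_algebra.
From mathcomp Require Import all_classical all_reals all_analysis.
From mathcomp Require Import measurable_realfun.
From mathcomp Require Import perm spectral sesquilinear complex.
From mathcomp Require Import ring lra zify.
Import Order.TTheory GRing.Theory Num.Theory.
Import numFieldNormedType.Exports.
Local Open Scope classical_set_scope.
Local Open Scope ring_scope.

Set Implicit Arguments.
Unset Strict Implicit.
Unset Printing Implicit Defensive.

(** The sums T_w f = sum_(k < N) w_k (M_(n_(k+1)) f - M_(n_k) f), with weights
    |w_k| <= 1, are bounded on L^p uniformly in w and N
    ([weighted_diff_bounded]); for coefficients that are bounded in this
    unconditional way, the convexity of L^p turns boundedness of the sums into
    smallness of their tails.

    The uniform bound is transferred from the integers: along an orbit,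
    T_w f (tau^i x) is the convolution of j |-> f (tau^j x) with a kernel built
    from normalised indicators of intervals of length n_k, and tau preserves
    integrals, so an l^p inequality for this kernel on [0, 2^M) averages into
    the L^p inequality.  The l^p inequality ([lacunary_kernel_lp]) is
    Calderon-Zygmund theory.  On l^2, the von Neumann inequality for the cyclic
    shift reduces it to a bound of the symbol on the unit circle: the symbol of
    the average of length n is within n|1-z| of 1 and at most 2/(n|1-z|), so
    lacunarity makes the differences absolutely summable.  The kernel satisfies
    the Hormander condition, again by summing geometric series along the n_k.
    The Calderon-Zygmund decomposition on dyadic blocks then gives the weak type
    (1,1) estimate ([weak_type]), Marcinkiewicz interpolation covers 1 < p < 2
    ([marcinkiewicz]), and duality covers p > 2 ([lp_duality]), the transpose of
    a convolution being conjugate to it by the reflection of the interval.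

    For p >= 2, suppose that the tails were not small: then there would be
    infinitely many successive blocks of norm bounded below, and Clarkson's
    inequality allows signs to be chosen one after the other so that the p-th
    moments add up ([pmoment_sign]), against the uniform bound
    ([small_tails_ge2]).  For p < 2 the function is approximated by a bounded one,
    for which smallness of tails in L^2 controls smallness in L^p, and the error
    is handled by the uniform bound ([small_tails_Lp]).  Any block of the permuted
    series is a weighted sum with weights 0 and 1 ([series_permuted]), so the
    permuted series is Cauchy, and L^p is complete ([Lp_convergent_cauchy]). *)

(** * Sums along lacunary sequences *)

(** The terms not exceeding x are dominated by a geometric series starting from
    the largest of them, hence by a multiple of x. *)
Lemma lacunary_sum_le (R : realFieldType) (lam : R) (a : nat -> R) (x : R) K :
    1 < lam -> (forall k, (k < K)%N -> 0 < a k) ->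
    (forall k, (k.+1 < K)%N -> lam * a k <= a k.+1) -> 0 <= x ->
  \sum_(k < K) (a k <= x)%R%:R * a k <= lam / (lam - 1) * x.
Proof.
move=> lam1 a0 alac x0.
have C0 : 0 <= lam / (lam - 1) by apply: divr_ge0; lra.
(* bounding by the smaller of x and the last term is what the induction carries *)
suff H : \sum_(k < K) (a k <= x)%R%:R * a k <=
    lam / (lam - 1) * (if K is K'.+1 then Num.min x (a K') else 0).
  apply: (le_trans H); apply: ler_wpM2l => //.
  by case: K {H a0 alac} => // K; rewrite ge_min lexx.
elim: K a0 alac => [|K IH] a0 alac; first by rewrite big_ord0 mulr0.
rewrite big_ord_recr /=.
have IH' : \sum_(k < K) (a k <= x)%R%:R * a k
    <= lam / (lam - 1) * Num.min x (a K / lam).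
  apply: (le_trans (IH _ _)); [by move=> k kK; apply/a0/ltnW|
    by move=> k kK; apply/alac/ltnW|apply: ler_wpM2l => //].
  case: K {IH} alac a0 => [|K] alac a0.
    by rewrite le_min x0 divr_ge0 // ?(ltW (a0 _ _)) //; lra.
  rewrite le_min !ge_min lexx /=; apply/orP; right.
  by rewrite ler_pdivlMr ?(lt_trans ltr01) // mulrC alac.
have aK0 : 0 < a K by apply: a0.
case: (leP (a K) x) => aK.
- rewrite mul1r.
  have -> : lam / (lam - 1) * a K = lam / (lam - 1) * (a K / lam) + a K.
    by field; apply/andP; split; apply/eqP; lra.
  rewrite lerD2r; apply: (le_trans IH'); apply: ler_wpM2l => //.
  by rewrite ge_min lexx orbT.
- rewrite mul0r addr0; apply: (le_trans IH'); apply: ler_wpM2l => //.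
  by rewrite ge_min lexx.
Qed.

(** The reversed sequence of inverses is lacunary. *)
Lemma lacunary_sum_ge (R : realFieldType) (lam : R) (a : nat -> R) (x : R) K :
    1 < lam -> (forall k, 0 < a k) ->
    (forall k, lam * a k <= a k.+1) -> 0 < x ->
  \sum_(k < K) (x <= a k)%R%:R / a k <= lam / (lam - 1) / x.
Proof.
move=> lam1 a0 alac x0.
have := @lacunary_sum_le R lam (fun k => (a (K - k.+1)%N)^-1) x^-1 K lam1.
rewrite (reindex_inj rev_ord_inj) /= => H.
rewrite -[leRHS]/(lam / (lam - 1) * x^-1).
under eq_bigr => i _ do rewrite -(lef_pV2 (_ : _ \in Num.pos) (_ : _ \in Num.pos)) ?posrE ?a0 //.
move: H; under eq_bigr => i _ do rewrite subnSK ?subKn // 1?ltnW //.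
apply => [k kK|k kK|]; rewrite ?invr_gt0 ?invr_ge0 ?a0 ?(ltW x0) //.
rewrite -[lam]invrK -invfM lef_pV2 ?posrE ?mulr_gt0 ?invr_gt0 ?a0 //; last by lra.
rewrite mulrC ler_pdivlMr ?(lt_trans ltr01) // mulrC.
by rewrite -(subnSK kK); apply: alac.
Qed.

(** * Stopping times on dyadic blocks *)
Lemma sum_block (R : nzRingType) (d m q : nat) : (q < m)%N -> (0 < d)%N ->
  \sum_(i < d * m | (i %/ d == q)%N) (1 : R) = d%:R.
Proof.
move=> qm d0.
rewrite -(big_mkord (fun i => i %/ d == q)%N (fun=> 1)).
have -> : \sum_(0 <= i < d * m | (i %/ d == q)%N) (1 : R)
    = \sum_(q * d <= i < q.+1 * d) 1.
  rewrite (@big_nat_widenl _ _ _ (q * d) 0) //.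
  rewrite (@big_nat_widen _ _ _ 0 (q.+1 * d) (d * m)); last by rewrite mulnC leq_mul2l qm orbT.
  apply: eq_bigl => i; rewrite /= eqn_leq -ltnS ltn_divLR // leq_divRL //.
  by rewrite andbC.
by rewrite big_const_nat -mulnBl subSnn mul1n iter_addr_0.
Qed.

Section Stopping.
Variables (R : realType) (M : nat) (f : nat -> R) (alpha : R).

Let same k i j := (i %/ 2 ^ k == j %/ 2 ^ k)%N.

Definition dyadic_avg k j : R := (\sum_(i < 2 ^ M | same k i j) `|f i|) / (2 ^ k)%:R.

(** The scale of the largest dyadic block around j on which the average of |f|
    exceeds alpha; it is 0 when no block does, so that j then forms a cell by
    itself. *)
Definition stop j : nat := \max_(k < M.+1 | alpha < dyadic_avg k j) k.

Lemma stop_le j : (stop j <= M)%N.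
Proof. by apply/bigmax_leqP => i _; rewrite -ltnS. Qed.

Lemma dyadic_avg_stop k j : (k <= M)%N -> (stop j < k)%N -> dyadic_avg k j <= alpha.
Proof.
move=> kM sk; rewrite leNgt; apply/negP => h.
have kM' : (k < M.+1)%N by rewrite ltnS.
have := @leq_bigmax_cond _ (fun k : 'I_M.+1 => alpha < dyadic_avg k j) (fun k => k : nat) (Ordinal kM') h.
by rewrite leqNgt -/(stop j) sk.
Qed.

Lemma same_up k l i j : (k <= l)%N -> same k i j -> same l i j.
Proof.
by move=> kl; rewrite /same -(subnKC kl) expnD !divnMA => /eqP ->.
Qed.

Lemma dyadic_avg_same k i j : same k i j -> dyadic_avg k i = dyadic_avg k j.
Proof.
by move=> /eqP ij; congr (_ / _); apply: eq_bigl => l; rewrite /same ij.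
Qed.

Lemma stopP j : stop j = 0%N \/ alpha < dyadic_avg (stop j) j.
Proof.
rewrite /stop; elim/big_ind: _ => [|a b|i]; [by left| |by right].
by rewrite maxnE; case: (leqP a b) => [/subnKC ->|/ltnW]//; rewrite -subn_eq0 => /eqP ->; rewrite addn0.
Qed.

(** When i lies in the stopping block of j, above that scale the blocks around i and around j are the
    same, so both points stop together: cells form a partition. *)
Lemma stop_cell i j : same (stop j) i j -> stop i = stop j.
Proof.
move=> ij; have [s0|aj] := stopP j.
  by move: ij; rewrite s0 /same expn0 !divn1 => /eqP ->.
apply/eqP; rewrite eqn_leq; apply/andP; split.
  rewrite leqNgt; apply/negP => sij.
  have := dyadic_avg_stop (stop_le i) sij.
  rewrite -(dyadic_avg_same (same_up (ltnW sij) ij)) leNgt.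
  by have [s0|->] := stopP i; rewrite // s0 in sij.
rewrite leqNgt; apply/negP => sij.
have := dyadic_avg_stop (stop_le j) sij.
by rewrite (dyadic_avg_same ij) leNgt aj.
Qed.

Definition cell j i := same (stop j) i j.

Lemma cellC i j : cell i j = cell j i.
Proof.
suff H a b : cell a b -> cell b a by apply/idP/idP; apply: H.
by move=> h; rewrite /cell (stop_cell h) /same eq_sym.
Qed.

Lemma cell_count j : (j < 2 ^ M)%N -> \sum_(i < 2 ^ M | cell j i) (1 : R) = (2 ^ stop j)%:R.
Proof.
move=> jM; rewrite /cell /same.
rewrite -(@sum_block R (2 ^ stop j) (2 ^ (M - stop j)) (j %/ 2 ^ stop j)) ?expn_gt0 //.
  by rewrite -expnD subnKC // stop_le.
by rewrite ltn_divLR ?expn_gt0 // -expnD subnK // stop_le.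
Qed.

(** The conditional expectation with respect to the partition into cells, that is
    the good part of the Calderon-Zygmund decomposition when F is f. *)
Definition stopped_average (F : nat -> R) j := (\sum_(i < 2 ^ M | cell j i) F i) / (2 ^ stop j)%:R.

(** Conditional expectations are self-adjoint and fix the functions that are
    constant on cells. *)
Lemma stopped_average_adjoint (u F : nat -> R) : (forall i j, cell j i -> u i = u j) ->
  \sum_(j < 2 ^ M) u j * stopped_average F j = \sum_(i < 2 ^ M) u i * F i.
Proof.
move=> uE; rewrite /stopped_average.
under eq_bigr => j _ do rewrite mulrA mulrAC mulr_sumr.
rewrite (exchange_big_dep predT) //=; apply: eq_bigr => i _.
rewrite (eq_bigr (fun j => u i * F i / (2 ^ stop i)%:R * 1)); last first.
  by move=> j ij; rewrite (uE _ _ ij) (stop_cell ij) mulr1 mulrAC.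
under eq_bigl do rewrite -cellC.
by rewrite -mulr_sumr cell_count // mulfVK // pnatr_eq0 expn_eq0.
Qed.

Lemma stopped_average_norm F j : `|stopped_average F j| <= stopped_average (fun i => `|F i|) j.
Proof.
rewrite /stopped_average normrM [`|_^-1|]ger0_norm ?invr_ge0 // ler_wpM2r ?invr_ge0 //.
exact: ler_norm_sum.
Qed.
End Stopping.

(** * The weak type (1,1) estimate *)
Definition kernel_op (R : realType) L (K : nat -> nat -> R) (f : nat -> R) (i : nat) : R :=
  \sum_(j < L) K i j * f j.

(** The dyadic blocks of length 2^k around i and j are equal or adjacent; this
    takes the place of the usual dilate of the block of j. *)
Definition near_block k (i j : nat) :=
  ((i %/ 2 ^ k <= (j %/ 2 ^ k).+1) && (j %/ 2 ^ k <= (i %/ 2 ^ k).+1))%N.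

Lemma near_block_count (R : realType) M k j : (k <= M)%N ->
  \sum_(i < 2 ^ M | near_block k i j) (1 : R) <= 3 * (2 ^ k)%:R.
Proof.
move=> kM.
have H q : \sum_(i < 2 ^ M | (i %/ 2 ^ k == q)%N) (1 : R) <= (2 ^ k)%:R.
  have [qm|qm] := ltnP q (2 ^ (M - k)).
    by rewrite -(@sum_block R (2 ^ k) (2 ^ (M - k)) q) ?expn_gt0 // -expnD subnKC.
  rewrite big1 ?ler0n // => i /eqP iq.
  have := ltn_ord i; rewrite -{2}(subnK kM) expnD -ltn_divLR ?expn_gt0 // iq.
  by rewrite ltnNge qm.
have -> : 3 * (2 ^ k)%:R = (2 ^ k)%:R + (2 ^ k)%:R + (2 ^ k)%:R :> R by ring.
apply: le_trans (lerD (lerD (H (j %/ 2 ^ k).-1) (H (j %/ 2 ^ k)%N)) (H (j %/ 2 ^ k).+1)).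
rewrite [leLHS]big_mkcond [X in _ <= X + _ + _]big_mkcond.
rewrite [X in _ <= _ + X + _]big_mkcond [X in _ <= _ + X]big_mkcond /= -!big_split /=; apply: ler_sum => i _.
rewrite /near_block; set a := (i %/ _)%N; set b := (j %/ _)%N.
case: ifP => [/andP[ab ba]|_]; last by rewrite !addr_ge0 //; case: ifP.
have : (a == b.-1) || (a == b) || (a == b.+1).
  by move: ab ba; clearbody a b; lia.
by move=> /orP[/orP[]|] ->; do !case: ifP => _; lra.
Qed.

Section WeakType.
Variables (R : realType) (M : nat) (K : nat -> nat -> R) (A B : R).
Local Notation L := (2 ^ M)%N.
Hypothesis A0 : 0 <= A.
Hypothesis K_L2 : forall h : nat -> R,
  \sum_(i < L) kernel_op L K h i ^+ 2 <= A * \sum_(i < L) h i ^+ 2.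
Hypothesis K_hor : forall k j c, (k <= M)%N -> (j < L)%N -> (c < L)%N ->
  (j %/ 2 ^ k = c %/ 2 ^ k)%N ->
  \sum_(i < L | ~~ near_block k i j) `|K i j - K i c| <= B.

(** The Calderon-Zygmund argument.  The good part g is bounded by 2 alpha, so the
    l^2 bound controls K g.  The bad part b = f - g has mean zero on each cell, so
    away from the cells K b only involves differences of the kernel, which are
    summable by the Hormander condition.  The cells together with their
    neighbours have at most 3 |f|_1 / alpha points.  The assumption on the whole
    interval makes every stopping block a proper one, with a parent of small
    average. *)
Lemma weak_type_aux (f : nat -> R) (alpha : R) : 0 < alpha ->
    dyadic_avg M f M 0 <= alpha ->
  \sum_(i < L) (alpha < `|kernel_op L K f i|)%R%:R <=
    (8 * A + 4 * B + 3) / alpha * \sum_(i < L) `|f i|.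
Proof.
move=> al0 tot.
set n1 := \sum_(i < L) `|f i|.
pose st := stop M f alpha.
pose Om j := alpha < dyadic_avg M f (st j) j.
pose g := stopped_average M f alpha f.
pose b j := f j - g j.
(* the left end of the cell of j, where the kernel is frozen *)
pose c j := (j %/ 2 ^ st j * 2 ^ st j)%N.
have avgE j : stopped_average M f alpha (fun i => `|f i|) j = dyadic_avg M f (st j) j by [].
have cellOm i j : cell M f alpha j i -> Om i = Om j.
  by move=> ij; rewrite /Om /st (stop_cell ij) (dyadic_avg_same _ _ ij).
have cell_c i j : cell M f alpha j i -> c i = c j.
  by move=> ij; rewrite /c /st (stop_cell ij) (eqP ij).
have avgM j : (j < L)%N -> dyadic_avg M f M j <= alpha.
  by move=> jL; rewrite (@dyadic_avg_same _ _ _ M j 0%N) // div0n divn_small.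
have avg2 j : (j < L)%N -> dyadic_avg M f (st j) j <= 2 * alpha.
  move=> jL; have [/= h|h] := leP (dyadic_avg M f (st j) j) alpha; first by lra.
  have [sM|sM] := ltnP (st j) M; last first.
    have E : st j = M by apply/eqP; rewrite eqn_leq sM stop_le.
    by move: h; rewrite E ltNge avgM.
  have := dyadic_avg_stop sM (ltnSn _) => {}h'.
  have : dyadic_avg M f (st j) j <= 2 * dyadic_avg M f (st j).+1 j.
    have E2 : (2 ^ (st j).+1)%:R = 2 * (2 ^ st j)%:R :> R by rewrite expnS natrM.
    rewrite /dyadic_avg E2 mulrCA invfM mulVKf // ler_wpM2r ?invr_ge0 //.
    rewrite [leLHS]big_mkcond [leRHS]big_mkcond; apply: ler_sum => i _.
    case: ifPn => [ij|_]; last by case: ifP.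
    by rewrite (same_up (leqnSn _) ij).
  by lra.
have g2 j : (j < L)%N -> `|g j| <= 2 * alpha.
  by move=> jL; apply: le_trans (stopped_average_norm _ _ _ _ _) _; rewrite avgE avg2.
have sumE : \sum_(j < L) stopped_average M f alpha (fun i => `|f i|) j = n1.
  have := @stopped_average_adjoint _ M f alpha (fun=> 1) (fun i => `|f i|) (fun _ _ _ => erefl).
  by under eq_bigr do rewrite mul1r; under [X in _ = X -> _]eq_bigr do rewrite mul1r.
have g1 : \sum_(j < L) `|g j| <= n1.
  by rewrite -sumE; apply: ler_sum => i _; exact: stopped_average_norm.
have n10 : 0 <= n1 by apply: sumr_ge0.
have Om1 : \sum_(j < L) (Om j)%:R <= n1 / alpha.
  rewrite ler_pdivlMr // mulr_suml.
  have E : \sum_(j < L) (Om j)%:R * stopped_average M f alpha (fun i => `|f i|) j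
      = \sum_(i < L) (Om i)%:R * `|f i|.
    by apply: (@stopped_average_adjoint _ M f alpha (fun j => (Om j)%:R)) => i j /cellOm ->.
  apply: (@le_trans _ _ (\sum_(j < L) (Om j)%:R * `|f j|)); last first.
    by apply: ler_sum => i _; case: (Om i); rewrite ?mul1r ?mul0r.
  rewrite -E; apply: ler_sum => i _; rewrite avgE.
  by case: (boolP (Om i)) => [h|_]; rewrite ?mul0r // !mul1r ltW.
(* the enlargement of the set of selected cells, outside which K b is summed *)
pose Os i := [exists j : 'I_L, Om j && near_block (st j) i j].
have Os1 : \sum_(i < L) (Os i)%:R <= 3 * (n1 / alpha).
  apply: le_trans (_ : 3 * \sum_(j < L) (Om j)%:R <= _); last by rewrite ler_pM2l.
  (* a point near a cell is counted once by each of the 2^st j points of that cell *)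
  apply: (@le_trans _ _ (\sum_(i < L) \sum_(j < L) ((Om j) && near_block (st j) i j)%:R / (2 ^ st j)%:R)).
    apply: ler_sum => i _; have [|_] := boolP (Os i); last first.
      by apply: sumr_ge0 => j _; rewrite divr_ge0.
    move=> /existsP[j /andP[Oj ij]].
    apply: (@le_trans _ _ (\sum_(j' < L | cell M f alpha j j') (2 ^ st j)%:R^-1)).
      rewrite (eq_bigr (fun _ => (2 ^ st j)%:R^-1 * 1)) ; last by move=> *; rewrite mulr1.
      by rewrite -mulr_sumr cell_count // mulVf // pnatr_eq0 expn_eq0.
    rewrite big_mkcond; apply: ler_sum => j' _; case: ifP => [jj'|_]; last by rewrite divr_ge0.
    rewrite (cellOm _ _ jj') Oj /= /st (stop_cell jj') /near_block.
    by rewrite (eqP jj') -/(near_block (stop M f alpha j) i j) ij mul1r.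
  rewrite exchange_big /= mulr_sumr; apply: ler_sum => j _.
  case: (Om j) => /=; last by rewrite big1 ?mulr0 // => i _; rewrite mul0r.
  rewrite -mulr_suml ler_pdivrMr ?ltr0n ?expn_gt0 // mulr1.
  apply: le_trans (near_block_count R j (stop_le M f alpha j)).
  by rewrite [leRHS]big_mkcond /=; apply: ler_sum => i _; case: near_block.
have b1 : \sum_(j < L) `|b j| <= 2 * n1.
  have -> : 2 * n1 = n1 + n1 by ring.
  apply: le_trans (lerD (lexx n1) g1); rewrite -big_split /=.
  by apply: ler_sum => j _; exact: ler_normB.
(* the values of K at the frozen points integrate to zero against b *)
have far i : ~~ Os i -> kernel_op L K b i = \sum_(j < L) (K i j - K i (c j)) * b j.
  move=> _; under [RHS]eq_bigr => j _ do rewrite mulrBl.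
  rewrite big_split /= sumrN.
  rewrite [X in _ - X](_ : _ = 0) ?subr0 //.
  have := @stopped_average_adjoint _ M f alpha (fun j => K i (c j)) f.
  move=> /(_ (fun i' j h => congr1 (K i) (cell_c _ _ h))) E.
  under eq_bigr => j _ do rewrite mulrBr.
  by rewrite big_split /= sumrN E subrr.
have b_Om j : (j < L)%N -> ~~ Om j -> b j = 0.
  move=> jL; rewrite /Om /st; have [s0 _|->//] := stopP M f alpha j.
  rewrite /b /g /stopped_average s0 expn0 divr1 (bigD1 (Ordinal jL)) /=; last by rewrite /cell eqxx.
  rewrite big1 ?addr0 ?subrr // => i /andP[].
  by rewrite /cell s0 expn0 !divn1 -(inj_eq val_inj) /= => ->.
have bK : \sum_(i < L | ~~ Os i) `|kernel_op L K b i| <= B * (2 * n1).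
  have B0 : 0 <= B.
    by apply: le_trans (K_hor (k := 0) (j := 0) (c := 0) _ _ _ _); rewrite ?sumr_ge0 ?expn_gt0.
  apply: le_trans (ler_wpM2l B0 b1).
  apply: (@le_trans _ _ (\sum_(i < L | ~~ Os i) \sum_(j < L) `|K i j - K i (c j)| * `|b j|)).
    apply: ler_sum => i /far ->; apply: le_trans (ler_norm_sum _ _ _) _.
    by apply: ler_sum => j _; rewrite normrM.
  rewrite exchange_big /= mulr_sumr; apply: ler_sum => j _.
  rewrite -mulr_suml; have [Oj|nOj] := boolP (Om j); last by rewrite b_Om // normr0 !mulr0.
  apply: ler_wpM2r => //.
  have cj : (c j <= j)%N by rewrite /c leq_trunc_div.
  apply: le_trans (K_hor (stop_le M f alpha j) (ltn_ord j) (leq_ltn_trans cj (ltn_ord j)) _); last first.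
    by rewrite /c mulnK // expn_gt0.
  rewrite [leLHS]big_mkcond [leRHS]big_mkcond; apply: ler_sum => i _.
  case: ifPn => [Oi|_]; last by case: ifP.
  rewrite (_ : ~~ near_block _ _ _) //; apply: contra Oi => ij.
  by apply/existsP; exists j; rewrite Oj ij.
have gK : \sum_(i < L) kernel_op L K g i ^+ 2 <= A * (2 * alpha * n1).
  apply: le_trans (K_L2 g) _; apply: ler_wpM2l => //.
  apply: le_trans (_ : 2 * alpha * \sum_(i < L) `|g i| <= _); last by rewrite ler_pM2l ?mulr_gt0.
  rewrite mulr_sumr; apply: ler_sum => i _.
  by rewrite -real_normK ?num_real // expr2 ler_wpM2r // g2.
have split_f i : kernel_op L K f i = kernel_op L K b i + kernel_op L K g i.
  rewrite /kernel_op -big_split; apply: eq_bigr => j _ /=.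
  by rewrite -mulrDr /b subrK.
have bound i : (alpha < `|kernel_op L K f i|)%R%:R <= (Os i)%:R
    + (~~ Os i)%:R * ((2 / alpha) * `|kernel_op L K b i|) + 4 / alpha ^+ 2 * kernel_op L K g i ^+ 2.
  have p1 : 0 <= 2 / alpha * `|kernel_op L K b i| by rewrite mulr_ge0 // divr_ge0 // ltW.
  have p2 : 0 <= 4 / alpha ^+ 2 * kernel_op L K g i ^+ 2.
    by rewrite mulr_ge0 ?sqr_ge0 // divr_ge0 ?sqr_ge0.
  case: ltP => h; last by rewrite !addr_ge0 // mulr_ge0.
  case: (Os i) => /=; first by rewrite mul0r addr0 lerDl.
  rewrite add0r mul1r.
  have uv : 1 < `|kernel_op L K b i| / alpha + `|kernel_op L K g i| / alpha.
    rewrite -mulrDl ltr_pdivlMr // mul1r.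
    by apply: lt_le_trans h _; rewrite split_f ler_normD.
  have -> : 4 / alpha ^+ 2 * kernel_op L K g i ^+ 2 = 4 * (`|kernel_op L K g i| / alpha) ^+ 2.
    by rewrite expr_div_n real_normK ?num_real // -mulrA [_^-1 * _]mulrC.
  rewrite -mulrA [alpha^-1 * _]mulrC.
  have := sqr_ge0 (2 * (`|kernel_op L K g i| / alpha) - 1).
  have : 0 <= `|kernel_op L K g i| / alpha by rewrite divr_ge0 // ltW.
  by nra.
apply: le_trans (_ : \sum_(i < L) ((Os i)%:R
    + (~~ Os i)%:R * ((2 / alpha) * `|kernel_op L K b i|)
    + 4 / alpha ^+ 2 * kernel_op L K g i ^+ 2) <= _).
  by apply: ler_sum => i _; exact: bound.
rewrite 2!big_split /= -mulr_sumr.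
apply: le_trans (_ : 3 * (n1 / alpha) + 2 / alpha * (B * (2 * n1))
  + 4 / alpha ^+ 2 * (A * (2 * alpha * n1)) <= _); last first.
  by rewrite le_eqVlt; apply/orP; left; apply/eqP; field; apply/eqP; lra.
rewrite !lerD //; last by rewrite ler_wpM2l // divr_ge0 ?sqr_ge0.
apply: le_trans (_ : 2 / alpha * \sum_(i < L | ~~ Os i) `|kernel_op L K b i| <= _); last first.
  by rewrite ler_wpM2l // divr_ge0 // ltW.
rewrite mulr_sumr [leRHS]big_mkcond; apply: ler_sum => i _.
by case: (Os i); rewrite ?mul0r ?mul1r.
Qed.

(** If already the average over the whole interval exceeds alpha, the number 2^M of
    points is at most |f|_1 / alpha. *)
Lemma weak_type (f : nat -> R) (alpha : R) : 0 < alpha ->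
  \sum_(i < L) (alpha < `|kernel_op L K f i|)%R%:R <=
    (8 * A + 4 * B + 3) / alpha * \sum_(i < L) `|f i|.
Proof.
move=> al0; have [tot|tot] := leP (dyadic_avg M f M 0) alpha.
  exact: weak_type_aux.
apply: (@le_trans _ _ L%:R).
  apply: (@le_trans _ _ (\sum_(i < L) 1)); last by rewrite sumr_const card_ord.
  by apply: ler_sum => i _; case: (_ < _)%R.
have {}tot : L%:R <= (\sum_(i < L) `|f i|) / alpha.
  rewrite ler_pdivlMr // ltW // mulrC -ltr_pdivlMr ?ltr0n ?expn_gt0 //.
  apply: (lt_le_trans tot); rewrite /dyadic_avg ler_wpM2r ?invr_ge0 //.
  rewrite big_mkcond; apply: ler_sum => i _; case: ifP => //.
have B0 : 0 <= B.
  by apply: le_trans (K_hor (k := 0) (j := 0) (c := 0) _ _ _ _); rewrite ?sumr_ge0 ?expn_gt0.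
apply: (le_trans tot); rewrite mulrAC -[_ * _ / _]mulrA ler_peMl //.
  by rewrite divr_ge0 ?sumr_ge0 // ltW.
by rewrite -[leLHS]add0r lerD ?addr_ge0 ?mulr_ge0 ?ler1n.
Qed.
End WeakType.

(** * Marcinkiewicz interpolation between weak type (1,1) and l^2 *)
Section Levels.
Variables (R : realType) (p : R).
Hypotheses (p_gt1 : 1 < p) (p_lt2 : p < 2).

Let lam1 : R := 2 `^ (p - 1).
Let lam2 : R := 2 `^ (2 - p).
Definition marcinkiewicz_cst (W A : R) : R :=
  4 `^ p * (W * (lam1 / (lam1 - 1)) + A * (lam2 / (lam2 - 1))).

Variable c : R.
Hypothesis c0 : 0 < c.
Let al m : R := c * 2 ^+ m.

Lemma level_gt0 m : 0 < al m. Proof. by rewrite mulr_gt0 ?exprn_gt0. Qed.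

Lemma powR2_gt1 (s : R) : 0 < s -> 1 < 2 `^ s.
Proof.
move=> s0; have := @gt0_ltr_powR R s s0 1 2; rewrite !nnegrE powR1; apply => //.
by rewrite ltr1n.
Qed.

Lemma level_lac (s : R) m : 2 `^ s * al m `^ s <= al m.+1 `^ s.
Proof.
by rewrite -powRM ?(ltW (level_gt0 _)) // /al exprS mulrCA.
Qed.

Lemma sum_levels_lt (N : nat) (t : R) : 0 <= t ->
  \sum_(m < N) (al m < t)%R%:R * al m `^ (p - 1) <=
  lam1 / (lam1 - 1) * t `^ (p - 1).
Proof.
move=> t0; apply: le_trans (@lacunary_sum_le R lam1 (fun m => al m `^ (p - 1)) (t `^ (p - 1)) N _ _ _ _).
- apply: ler_sum => m _; apply: ler_wpM2r; first exact: powR_ge0.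
  case: ltP => // h; rewrite ge0_ler_powR ?nnegrE ?(ltW (level_gt0 _)) // ?(ltW h) //.
  by rewrite subr_ge0 ltW.
- by apply: powR2_gt1; rewrite subr_gt0.
- by move=> k _; rewrite powR_gt0 // level_gt0.
- by move=> k _; exact: level_lac.
- exact: powR_ge0.
Qed.

Lemma sum_levels_ge (N : nat) (t : R) : 0 <= t ->
  \sum_(m < N) (t <= al m)%R%:R / al m `^ (2 - p) * t ^+ 2 <=
  lam2 / (lam2 - 1) * t `^ p.
Proof.
rewrite le_eqVlt => /predU1P[<-|t0].
  by rewrite powR0 ?gt_eqF ?(lt_trans ltr01) // mulr0 big1 // => i _; rewrite expr0n mulr0.
rewrite -mulr_suml -ler_pdivlMr ?exprn_gt0 //.
have -> : lam2 / (lam2 - 1) * t `^ p / t ^+ 2 = lam2 / (lam2 - 1) / t `^ (2 - p).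
  have -> : t `^ (2 - p) = t ^+ 2 / t `^ p.
    by rewrite powRB ?powR_mulrn ?ltW // gt_eqF // implybT.
  by rewrite invf_div mulrA.
apply: le_trans (@lacunary_sum_ge R lam2 (fun m => al m `^ (2 - p)) (t `^ (2 - p)) N _ _ _ _).
- apply: ler_sum => m _; apply: ler_wpM2r; first by rewrite invr_ge0 powR_ge0.
  case: (leP t (al m)) => // h; rewrite ge0_ler_powR ?nnegrE ?(ltW (level_gt0 _)) // ?(ltW t0) //.
  by rewrite subr_ge0 ltW.
- by apply: powR2_gt1; rewrite subr_gt0.
- by move=> k; rewrite powR_gt0 // level_gt0.
- by move=> k; exact: level_lac.
- exact: powR_gt0.
Qed.

(** A value t above 2c lies in some interval (2 al m, 4 al m], whose level alone
    accounts for t^p; the values below contribute a term that vanishes with c. *)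
Lemma layer_cake (N : nat) (t : R) : 0 <= t -> t <= c * 2 ^+ N ->
  t `^ p <= (2 * c) `^ p + 4 `^ p * \sum_(m < N) (2 * al m < t)%R%:R * al m `^ p.
Proof.
move=> t0; have p0 : 0 <= p by rewrite ltW // (lt_trans ltr01).
have c20 : 0 <= 2 * c by rewrite mulr_ge0 ?ltW.
have al2 m : 0 <= 4 * al m by rewrite mulr_ge0 ?ltW ?level_gt0.
elim: N => [|N IH] tN.
  rewrite big_ord0 mulr0 addr0 ge0_ler_powR ?nnegrE //.
  by apply: le_trans tN _; rewrite expr0; move: c0; lra.
have S0 N' : 0 <= \sum_(m < N') (2 * al m < t)%R%:R * al m `^ p.
  by apply: sumr_ge0 => i _; rewrite mulr_ge0 ?powR_ge0.
have [tN'|tN'] := leP t (al N).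
  apply: le_trans (IH tN') _; rewrite lerD2l ler_wpM2l ?powR_ge0 // big_ord_recr /= lerDl.
  by rewrite mulr_ge0 ?powR_ge0.
have [h|h] := leP t (2 * c).
  apply: le_trans (_ : (2 * c) `^ p <= _); last by rewrite lerDl mulr_ge0 ?powR_ge0.
  by rewrite ge0_ler_powR ?nnegrE.
case: N {IH} tN tN' => [|N] tN tN'.
  by move: tN h; rewrite expr1 mulrC => tN; rewrite ltNge tN.
rewrite 2!big_ord_recr /=.
have -> : 2 * al N < t by move: tN'; rewrite /al exprS mulrCA.
have := S0 N => S0N; set S := \sum_(i < N) _ in S0N *.
apply: (@le_trans _ _ (4 `^ p * al N `^ p)).
  rewrite -powRM ?(ltW (level_gt0 _)) // ge0_ler_powR ?nnegrE //.
  by apply: (le_trans tN); rewrite /al !exprS; lra.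
rewrite mul1r -[leLHS]add0r lerD ?powR_ge0 // ler_wpM2l ?powR_ge0 //.
by rewrite -addrA addrCA lerDl addr_ge0 // mulr_ge0 ?powR_ge0.
Qed.
End Levels.

Section Interpolation.
Variables (R : realType) (p : R) (L : nat) (K : nat -> nat -> R) (W A : R).
Hypotheses (p_gt1 : 1 < p) (p_lt2 : p < 2) (W0 : 0 <= W) (A0 : 0 <= A).
Hypothesis K_L2 : forall h : nat -> R,
  \sum_(i < L) kernel_op L K h i ^+ 2 <= A * \sum_(i < L) h i ^+ 2.
Hypothesis K_weak : forall (f : nat -> R) (alpha : R), 0 < alpha ->
  \sum_(i < L) (alpha < `|kernel_op L K f i|)%R%:R <= W / alpha * \sum_(i < L) `|f i|.

(** At height alpha, f is cut into its parts above and below alpha: the first is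
    measured by the weak type estimate, the second by the l^2 bound.  The powers of
    alpha are distributed so that each sum over the levels is geometric. *)
Lemma truncated_level (f : nat -> R) (alpha : R) : 0 < alpha ->
  \sum_(i < L) (2 * alpha < `|kernel_op L K f i|)%R%:R * alpha `^ p <=
  W * \sum_(i < L) (alpha < `|f i|)%R%:R * alpha `^ (p - 1) * `|f i|
  + A * \sum_(i < L) (`|f i| <= alpha)%R%:R / alpha `^ (2 - p) * `|f i| ^+ 2.
Proof.
move=> al0.
pose f1 i := (alpha < `|f i|)%R%:R * f i.
pose f2 i := (`|f i| <= alpha)%R%:R * f i.
have fE i : kernel_op L K f i = kernel_op L K f1 i + kernel_op L K f2 i.
  rewrite /kernel_op -big_split; apply: eq_bigr => j _ /=; rewrite /f1 /f2.
  by case: ltP => _; rewrite ?mul0r ?mul1r ?mulr0 ?addr0 ?add0r.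
have bound i : (2 * alpha < `|kernel_op L K f i|)%R%:R <=
   (alpha < `|kernel_op L K f1 i|)%R%:R + alpha ^- 2 * kernel_op L K f2 i ^+ 2.
  have h0 : 0 <= alpha ^- 2 * kernel_op L K f2 i ^+ 2.
    by rewrite mulr_ge0 ?invr_ge0 ?sqr_ge0.
  case: ltP => h; last by rewrite addr_ge0.
  case: ltP => h1; first by rewrite lerDl.
  rewrite add0r mulrC ler_pdivlMr ?exprn_gt0 // mul1r -[leRHS]real_normK ?num_real //.
  rewrite ler_pXn2r ?nnegrE ?normr_ge0 ?(ltW al0) //.
  have := ler_normD (kernel_op L K f1 i) (kernel_op L K f2 i); rewrite -fE.
  by move: h h1; lra.
rewrite -mulr_suml.
apply: (@le_trans _ _ ((W / alpha * \sum_(i < L) `|f1 i| + alpha ^- 2 * (A * \sum_(i < L) f2 i ^+ 2)) * alpha `^ p)).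
  apply: ler_wpM2r; first exact: powR_ge0.
  apply: (@le_trans _ _ (\sum_(i < L) ((alpha < `|kernel_op L K f1 i|)%R%:R + alpha ^- 2 * kernel_op L K f2 i ^+ 2))).
    by apply: ler_sum => i _; exact: bound.
  rewrite big_split /= -mulr_sumr lerD ?K_weak //.
  by rewrite ler_wpM2l ?K_L2 // invr_ge0 sqr_ge0.
have alB : alpha `^ (p - 1) = alpha `^ p / alpha.
  by rewrite powRB ?powRr1 ?ltW // gt_eqF // implybT.
have al2 : alpha `^ (2 - p) = alpha ^+ 2 / alpha `^ p.
  by rewrite powRB ?powR_mulrn ?ltW // gt_eqF // implybT.
rewrite mulrDl le_eqVlt; apply/orP; left; apply/eqP; congr (_ + _).
  rewrite -!mulrA; congr (_ * _); rewrite mulrCA mulr_suml; apply: eq_bigr => i _.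
  rewrite alB /f1 normrM; case: ltP => _; by rewrite ?normr0 ?normr1 ?mulr1n ?mulr0n; ring.
rewrite mulrCA -!mulrA; congr (_ * _); rewrite mulrCA mulr_suml; apply: eq_bigr => i _.
rewrite al2 /f2; case: ltP => _; rewrite ?mulr1n ?mulr0n ?mul0r ?mul1r ?expr0n ?mul0r ?mulr0 // real_normK ?num_real // invf_div.
by ring.
Qed.

(** Summing over the levels c 2^m and exchanging sums bounds the left-hand side up
    to the contribution of the values below 2c, which is made smaller than any e. *)
Lemma marcinkiewicz (f : nat -> R) :
  \sum_(i < L) `|kernel_op L K f i| `^ p <= marcinkiewicz_cst p W A * \sum_(i < L) `|f i| `^ p.
Proof.
have p0 : 0 < p by apply: lt_trans p_gt1.
apply/ler_addgt0Pr => e e0.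
(* chosen so that the L values below 2c contribute less than e *)
pose c := (e / L.+1%:R) `^ (p^-1) / 2.
have c0 : 0 < c by rewrite divr_gt0 // powR_gt0 // divr_gt0.
have c2 : (2 * c) `^ p = e / L.+1%:R.
  by rewrite /c mulrCA mulfV // mulr1 -powRrM mulVf ?gt_eqF // powRr1 // divr_ge0 // ltW.
have [N HN] : exists N, forall i : 'I_L, `|kernel_op L K f i| <= c * 2 ^+ N.
  pose N (i : 'I_L) := Num.truncn (`|kernel_op L K f i| / c).
  exists (\max_i N i)%N => i.
  rewrite mulrC -ler_pdivrMr //.
  apply: le_trans (ltW (truncnS_gt _)) _; rewrite -natrX ler_nat.
  by apply: leq_ltn_trans (ltn_expl _ (ltnSn 1)); exact: leq_bigmax.
pose al m := c * 2 ^+ m.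
apply: (@le_trans _ _ (\sum_(i < L) ((2 * c) `^ p +
    4 `^ p * \sum_(m < N) (2 * al m < `|kernel_op L K f i|)%R%:R * al m `^ p))).
  by apply: ler_sum => i _; apply: layer_cake.
rewrite big_split /= addrC lerD //; last first.
  rewrite sumr_const card_ord c2 -[_ *+ L]mulr_natr mulrAC -mulrA ler_piMr ?(ltW e0) //.
  by rewrite ler_pdivrMr // mul1r ler_nat.
rewrite -mulr_sumr /marcinkiewicz_cst -mulrA ler_wpM2l ?powR_ge0 //.
rewrite exchange_big /=.
apply: (@le_trans _ _ (\sum_(m < N)
  (W * \sum_(i < L) (al m < `|f i|)%R%:R * al m `^ (p - 1) * `|f i|
  + A * \sum_(i < L) (`|f i| <= al m)%R%:R / al m `^ (2 - p) * `|f i| ^+ 2))).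
  by apply: ler_sum => m _; apply: truncated_level; exact: level_gt0.
rewrite big_split /= -!mulr_sumr mulrDl -!mulrA.
rewrite lerD // ler_wpM2l // exchange_big /= mulrA mulr_sumr.
  apply: ler_sum => i _; rewrite -mulr_suml -(mulr_powRB1 (normr_ge0 (f i)) p0).
  rewrite mulrCA mulrC ler_wpM2l //.
  exact: sum_levels_lt.
by apply: ler_sum => i _; exact: sum_levels_ge.
Qed.
End Interpolation.

(** * Duality *)
Section Duality.
Variables (R : realType) (L : nat) (K : nat -> nat -> R).

Lemma kernel_op_adjoint (f g : nat -> R) :
  \sum_(i < L) kernel_op L K f i * g i = \sum_(j < L) f j * kernel_op L (fun a b => K b a) g j.
Proof.
rewrite /kernel_op; under eq_bigr do rewrite mulr_suml.
rewrite exchange_big /=; apply: eq_bigr => j _; rewrite mulr_sumr.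
by apply: eq_bigr => i _; rewrite mulrAC mulrC.
Qed.

(** Testing K f against its dual function |K f|^(p-1) sgn(K f) gives
    |K f|_p^p = <f, K^T g> with |g|_q^q = |K f|_p^p.  Young's inequality with a
    parameter s bounds this by s^p |f|_p^p + s^-q C |K f|_p^p, and the last term is
    absorbed. *)
Lemma lp_duality (p q C : R) : 1 < p -> 1 < q -> p^-1 + q^-1 = 1 -> 0 <= C ->
  (forall g : nat -> R, \sum_(i < L) `|kernel_op L (fun a b => K b a) g i| `^ q <= C * \sum_(i < L) `|g i| `^ q) ->
  forall f : nat -> R, \sum_(i < L) `|kernel_op L K f i| `^ p <=
    2 * (((2 * C + 1) `^ q^-1) `^ p) * \sum_(i < L) `|f i| `^ p.
Proof.
move=> p1 q1 pq C0 KT f.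
have p0 : 0 < p by apply: lt_trans p1.
have q0 : 0 < q by apply: lt_trans q1.
(* then C / s^q is less than 1/2 *)
set s := (2 * C + 1) `^ q^-1.
have s0 : 0 < s by rewrite powR_gt0 // ltr_wpDl // mulr_ge0.
pose g i := Num.sg (kernel_op L K f i) * `|kernel_op L K f i| `^ (p - 1).
have gq i : `|g i| `^ q = `|kernel_op L K f i| `^ p.
  rewrite /g normrM; have [->|h] := eqVneq (kernel_op L K f i) 0.
    by rewrite sgr0 normr0 mul0r !powR0 ?gt_eqF.
  rewrite normr_sg h mul1r ger0_norm ?powR_ge0 // -powRrM; congr (_ `^ _).
  have : q = p / (p - 1).
    have p1' : p - 1 != 0 by rewrite subr_eq0 gt_eqF.
    have -> : q = (1 - p^-1)^-1 by rewrite -pq addrAC subrr add0r invrK.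
    by field; rewrite p1' gt_eqF // .
  by move=> ->; rewrite mulrCA mulfV ?mulr1 // subr_eq0 gt_eqF.
have gE i : kernel_op L K f i * g i = `|kernel_op L K f i| `^ p.
  by rewrite /g mulrA -[kernel_op _ _ _ _ * _]mulrC -normrEsg mulr_powRB1.
set X := \sum_(i < L) `|kernel_op L K f i| `^ p.
have XE : X = \sum_(j < L) f j * kernel_op L (fun a b => K b a) g j.
  by rewrite -kernel_op_adjoint; apply: eq_bigr => i _; rewrite gE.
have young (a b : R) : a * b <= s `^ p * `|a| `^ p + (s `^ q)^-1 * `|b| `^ q.
  apply: (@le_trans _ _ ((s * `|a|) * (s^-1 * `|b|))).
    by rewrite mulrACA mulfV ?gt_eqF // mul1r -normrM ler_norm.
  apply: le_trans (conjugate_powR _ _ p0 q0 pq) _; rewrite ?mulr_ge0 ?invr_ge0 ?(ltW s0) //.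
  rewrite !powRM ?invr_ge0 ?(ltW s0) // lerD //.
    by rewrite ler_pdivrMr // ler_peMr ?mulr_ge0 ?powR_ge0 // ltW.
  rewrite ler_pdivrMr // -powR_inv1 ?(ltW s0) // powRAC powR_inv1 ?powR_ge0 //.
  by rewrite ler_peMr ?mulr_ge0 ?invr_ge0 ?powR_ge0 // ltW.
have sq : s `^ q = 2 * C + 1.
  by rewrite /s -powRrM mulVf ?gt_eqF // powRr1 // addr_ge0 // mulr_ge0.
have X0 : 0 <= X by apply: sumr_ge0 => i _; exact: powR_ge0.
have : X <= s `^ p * (\sum_(i < L) `|f i| `^ p) + (2 * C + 1)^-1 * (C * X).
  rewrite {1}XE.
  apply: (@le_trans _ _ (\sum_(j < L) (s `^ p * `|f j| `^ p +
     (s `^ q)^-1 * `|kernel_op L (fun a b => K b a) g j| `^ q))).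
    by apply: ler_sum => j _; exact: young.
  rewrite big_split /= -!mulr_sumr sq lerD // ler_wpM2l ?invr_ge0 ?addr_ge0 ?mulr_ge0 //.
  by apply: le_trans (KT g) _; under eq_bigr do rewrite gq.
have : (2 * C + 1)^-1 * (C * X) <= 2^-1 * X.
  rewrite mulrA ler_wpM2r // mulrC ler_pdivrMr; last by rewrite ltr_wpDl // mulr_ge0.
  by lra.
rewrite -[2 * _ * _]mulrA; set Y := s `^ p * _; lra.
Qed.
End Duality.


(** * The l^2 bound *)
Section VonNeumann.
Local Open Scope sesquilinear_scope.
Variable C : numClosedFieldType.

Lemma sqnormE n (v : 'rV[C]_n) : \sum_j `|v 0 j| ^+ 2 = (v *m v ^t*) 0 0.
Proof. by rewrite mxE; apply: eq_bigr => j _; rewrite !mxE normCK. Qed.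

Lemma sqnorm_unitary n (v : 'rV[C]_n) (P : 'M[C]_n) : P \is unitarymx ->
  \sum_j `|(v *m P) 0 j| ^+ 2 = \sum_j `|v 0 j| ^+ 2.
Proof.
move=> /unitarymxP PP.
by rewrite !sqnormE trmx_mul map_mxM mulmxA -[v *m P *m _]mulmxA PP mulmx1.
Qed.

(** A unitary matrix is unitarily diagonalizable with eigenvalues of modulus 1, on
    which q is bounded by c. *)
Lemma von_neumann n (S : 'M[C]_n.+1) (q : {poly C}) (c : C) (v : 'rV[C]_n.+1) :
    S \is unitarymx -> (forall z, `|z| = 1 -> `|q.[z]| <= c) ->
  \sum_j `|(v *m horner_mx S q) 0 j| ^+ 2 <= c ^+ 2 * \sum_j `|v 0 j| ^+ 2.
Proof.
move=> S_unitary qc.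
have S_normal : S \is normalmx.
  apply/normalmxP; rewrite (unitarymxP _) //.
  by rewrite -invmx_unitary // mulVmx // unitarymx_unit.
have /orthomx_spectralP SE := S_normal.
set P := spectralmx S in SE; set D := spectral_diag S in SE.
have P_unitary : P \is unitarymx by exact: spectral_unitarymx.
have P_unit : P \in unitmx by exact: unitarymx_unit.
have Pt_unitary : invmx P \is unitarymx by rewrite invmx_unitary // trmxC_unitary.
have DE : diag_mx D = P *m S *m invmx P.
  by rewrite SE !mulmxA mulmxV // mul1mx mulmxK.
have D_unitary : diag_mx D \is unitarymx by rewrite DE !mul_unitarymx.
have D1 j : `|D 0 j| = 1.
  have /unitarymxP/matrixP/(_ j j) := D_unitary.
  rewrite tr_diag_mx map_diag_mx mulmx_diag !mxE eqxx !mulr1n -normCK => /eqP.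
  by rewrite sqrp_eq1 // => /eqP.
rewrite SE horner_mx_uconjC // horner_mx_diag !mulmxA.
rewrite sqnorm_unitary // -(sqnorm_unitary v Pt_unitary) mulr_sumr.
apply: ler_sum => j _; rewrite mul_mx_diag !mxE normrM exprMn mulrC ler_wpM2r ?exprn_ge0 //.
by rewrite lerXn2r ?nnegrE // ?(le_trans _ (qc _ (D1 j))) // qc.
Qed.
End VonNeumann.

Section Symbol.
Variable R : realType.
Implicit Type z : R[i].
Local Notation normc := (@Normc.normc R).

Lemma normcE z : `|z| = (normc z)%:C%C. Proof. by []. Qed.

Lemma normc_le z (r : R) : (normc z <= r) = (`|z| <= r%:C%C).
Proof. by rewrite normcE lecR. Qed.

Lemma normc_sum (I : Type) (r : seq I) (P : pred I) (F : I -> R[i]) :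
  normc (\sum_(i <- r | P i) F i) <= \sum_(i <- r | P i) normc (F i).
Proof.
rewrite normc_le; apply: (le_trans (ler_norm_sum _ _ _)).
by rewrite rmorph_sum /=.
Qed.

Lemma normcB z1 z2 : normc (z1 - z2) <= normc z1 + normc z2.
Proof. by rewrite normc_le rmorphD /= -!normcE ler_normB. Qed.

Lemma normcD z1 z2 : normc (z1 + z2) <= normc z1 + normc z2.
Proof. by rewrite normc_le rmorphD /= -!normcE ler_normD. Qed.

Lemma normcM z1 z2 : normc (z1 * z2) = normc z1 * normc z2.
Proof. by apply: complexI; rewrite rmorphM /= -!normcE normrM. Qed.

Lemma normcX z n : normc (z ^+ n) = normc z ^+ n.
Proof. by apply: complexI; rewrite rmorphXn /= -!normcE normrX. Qed.

Lemma normc_real (r : R) : normc r%:C%C = `|r|.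
Proof. by rewrite /= expr0n /= addr0 sqrtr_sqr. Qed.

Lemma normc0E : normc 0 = 0.
Proof. by apply: complexI; rewrite -normcE normr0. Qed.

Lemma normcVE z : normc z^-1 = (normc z)^-1.
Proof. by apply: complexI; rewrite fmorphV /= -!normcE normfV. Qed.

Lemma normcNE z : normc (- z) = normc z.
Proof. by apply: complexI; rewrite -!normcE normrN. Qed.

Lemma normc_ge0 z : 0 <= normc z. Proof. by rewrite -lecR -normcE rmorph0. Qed.
Lemma normc_nat n : normc n%:R = n%:R.
Proof. by rewrite -(rmorph_nat (real_complex R)) normc_real ger0_norm. Qed.

(** The Fourier symbol of the average of length n, evaluated at z = e^(i theta). *)
Definition avg_symbol z n : R[i] := n%:R^-1 * \sum_(1 <= t < n.+1) z ^+ t.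

Lemma normc_expB1 z t : normc z = 1 -> normc (z ^+ t - 1) <= t%:R * normc (1 - z).
Proof.
move=> z1; elim: t => [|t IH]; first by rewrite expr0 subrr mul0r normc0E.
have -> : z ^+ t.+1 - 1 = (z ^+ t - 1) - z ^+ t * (1 - z) by rewrite exprSr; ring.
apply: le_trans (normcB _ _) _.
by rewrite normcM normcX z1 expr1n mul1r -natr1 mulrDl mul1r lerD2r.
Qed.

Lemma avg_symbol_near1 z n : (0 < n)%N -> normc z = 1 ->
  normc (avg_symbol z n - 1) <= n%:R * normc (1 - z).
Proof.
move=> n0 z1.
have -> : avg_symbol z n - 1 = n%:R^-1 * \sum_(1 <= t < n.+1) (z ^+ t - 1).
  rewrite big_split /= mulrDr -/(avg_symbol z n); congr (_ + _).
  by rewrite big_const_nat iter_addr_0 subn1 /= mulNrn mulrN mulVf // pnatr_eq0 -lt0n.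
rewrite normcM normcVE normc_nat mulrC ler_pdivrMr ?ltr0n //.
apply: le_trans (normc_sum _ _ _) _.
apply: (@le_trans _ _ (\sum_(1 <= t < n.+1) n%:R * normc (1 - z))).
  rewrite !big_nat; apply: ler_sum => t /andP[_ tn].
  apply: le_trans (normc_expB1 t z1) _.
  by rewrite ler_wpM2r ?normc_ge0 // ler_nat.
by rewrite big_const_nat iter_addr_0 subn1 /= mulr_natr.
Qed.

(** Multiplication by 1 - z telescopes the geometric sum to z - z^(n+1). *)
Lemma avg_symbol_decay z n : (0 < n)%N -> normc z = 1 -> 0 < normc (1 - z) ->
  normc (avg_symbol z n) <= 2 / (n%:R * normc (1 - z)).
Proof.
move=> n0 z1 d0.
rewrite ler_pdivlMr ?mulr_gt0 ?ltr0n // mulrCA -normcM /avg_symbol.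
rewrite -mulrA normcM normcVE normc_nat mulVKf ?pnatr_eq0 -?lt0n //.
rewrite mulr_suml (eq_bigr (fun t => - (z ^+ t.+1 - z ^+ t))); last by move=> t _; rewrite exprSr; ring.
rewrite sumrN telescope_sumr // opprB.
by apply: le_trans (normcB _ _) _; rewrite !normcX z1 !expr1n; lra.
Qed.

(** Compare the symbol with the indicator of n <= x, where x = 1 / |1 - z|.  The
    error is at most n/x for n <= x and 2x/n for n >= x, which is summable along a
    lacunary sequence; the indicators decrease along the sequence, so their
    variation is at most 1. *)
Lemma sum_symbol_diff (lam : R) (n : nat -> nat) N z :
    1 < lam -> (forall k, (0 < n k)%N) ->
    (forall k, lam * (n k)%:R <= (n k.+1)%:R) -> normc z = 1 ->
  \sum_(k < N) normc (avg_symbol z (n k.+1) - avg_symbol z (n k)) <=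
  6 * (lam / (lam - 1)) + 1.
Proof.
move=> lam1 n0 nlac z1.
have Lam0 : 0 <= lam / (lam - 1) by apply: divr_ge0; lra.
have := normc_ge0 (1 - z); rewrite le_eqVlt => /predU1P[/esym d0|d0].
  have /eqP : `|1 - z| = 0 by rewrite normcE d0.
  rewrite normr_eq0 subr_eq0 => /eqP <-.
  have E m : (0 < m)%N -> avg_symbol 1 m = 1.
    move=> m0; rewrite /avg_symbol; under eq_bigr do rewrite expr1n.
    by rewrite big_const_nat iter_addr_0 subn1 mulVf // pnatr_eq0 -lt0n.
  rewrite big1 => [|k _]; first by rewrite addr_ge0 // mulr_ge0.
  by rewrite !E // subrr normc0E.
set d := normc (1 - z) in d0.
pose x := d^-1; have x0 : 0 < x by rewrite invr_gt0.
pose ind m : R[i] := ((m%:R <= x)%R : nat)%:R.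
pose bd m : R := (m%:R <= x)%R%:R * (m%:R / x) + 2 * ((x <= m%:R)%R%:R * (x / m%:R)).
have near m : (0 < m)%N -> normc (avg_symbol z m - ind m) <= bd m.
  move=> m0; rewrite /ind /bd.
  have m0' : 0 < m%:R :> R by rewrite ltr0n.
  have [mx|mx] := leP m%:R x.
    apply: (@le_trans _ _ (m%:R / x)).
      by rewrite /x invrK; exact: avg_symbol_near1.
    rewrite mul1r lerDl mulr_ge0 // mulr_ge0 // divr_ge0 ?ltW //.
  rewrite subr0 mul0r add0r (ltW mx) mul1r.
  by apply: le_trans (avg_symbol_decay m0 z1 d0) _; rewrite -/d invfM [_^-1 * d^-1]mulrC.
have sum_bd (m : nat -> nat) : (forall k, (0 < m k)%N) ->
    (forall k, lam * (m k)%:R <= (m k.+1)%:R) ->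
    \sum_(k < N) bd (m k) <= 3 * (lam / (lam - 1)).
  move=> m0 mlac; rewrite big_split /= -mulr_sumr.
  have -> : 3 * (lam / (lam - 1)) = lam / (lam - 1) * x / x + 2 * (x * (lam / (lam - 1) / x)).
    by field; apply/andP; split; apply/eqP; lra.
  rewrite lerD //.
    under eq_bigr do rewrite mulrA.
    rewrite -mulr_suml ler_pM2r ?invr_gt0 //.
    by apply: (@lacunary_sum_le _ _ (fun k => (m k)%:R)) => // [k _|]; rewrite ?ltr0n ?m0 // ltW.
  rewrite ler_pM2l //; under eq_bigr do rewrite mulrCA.
  rewrite -mulr_sumr ler_pM2l //.
  by apply: (@lacunary_sum_ge _ _ (fun k => (m k)%:R)) => // k; rewrite ltr0n m0.
have mono k : (n k <= n k.+1)%N.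
  rewrite -(ler_nat R); apply: le_trans (nlac k); rewrite ler_peMl //; exact: ltW.
have tele : \sum_(k < N) normc (ind (n k.+1) - ind (n k)) <= 1.
  apply: (@le_trans _ _ (\sum_(k < N) (((n k)%:R <= x)%R%:R - ((n k.+1)%:R <= x)%R%:R))).
    apply: ler_sum => k _; rewrite /ind.
    have : ((n k)%:R <= (n k.+1)%:R :> R) by rewrite ler_nat.
    case: (leP (n k.+1)%:R x) => h1; case: (leP (n k)%:R x) => h2 h3.
    - by rewrite !subrr normc0E.
    - by have := lt_le_trans h2 (le_trans h3 h1); rewrite ltxx.
    - by rewrite sub0r normcNE normc_nat subr0.
    - by rewrite !subr0 normc0E.
  under eq_bigr do rewrite -opprB.
  rewrite sumrN -(big_mkord predT (fun k => ((n k.+1)%:R <= x)%R%:R - ((n k)%:R <= x)%R%:R)).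
  by rewrite telescope_sumr // opprB; case: (leP (n 0%N)%:R x) => _; case: (leP (n N)%:R x) => _; rewrite ?subr0 ?subrr ?sub0r ?ler0N1 ?lerN10.
apply: (@le_trans _ _ (\sum_(k < N) (bd (n k.+1) + bd (n k) + normc (ind (n k.+1) - ind (n k))))).
  apply: ler_sum => k _.
  have -> : avg_symbol z (n k.+1) - avg_symbol z (n k) =
    (avg_symbol z (n k.+1) - ind (n k.+1)) - (avg_symbol z (n k) - ind (n k))
    + (ind (n k.+1) - ind (n k)) by ring.
  apply: le_trans (normcD _ _) _; rewrite lerD2r.
  by apply: le_trans (normcB _ _) _; rewrite lerD // near.
rewrite big_split /= lerD // big_split /=.
have -> : 6 * (lam / (lam - 1)) = 3 * (lam / (lam - 1)) + 3 * (lam / (lam - 1)) by ring.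
by rewrite lerD //; [apply: (sum_bd (fun k => n k.+1))|apply: sum_bd].
Qed.
End Symbol.

Definition average_kernel (R : realType) (n i j : nat) : R := ((i < j) && (j <= i + n))%N%:R / n%:R.

(** Acting on the values of f along an orbit, this matrix computes the values of the
    weighted sum of differences of averages along the same orbit. *)
Definition lacunary_kernel (R : realType) (n : nat -> nat) (w : nat -> R) (N i j : nat) : R :=
  \sum_(k < N) w k * (average_kernel R (n k.+1) i j - average_kernel R (n k) i j).

Section LacunaryL2.
Variable R : realType.

Definition avg_poly (n : nat) : {poly R[i]} := n%:R^-1 *: \sum_(1 <= t < n.+1) 'X^t.

Lemma horner_avg_poly z n : (avg_poly n).[z] = avg_symbol z n.
Proof.
rewrite /avg_poly /avg_symbol hornerZ horner_sum; congr (_ * _).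
by apply: eq_bigr => t _; rewrite hornerXn.
Qed.

(** The permutation is inverted because a permutation matrix acts on the indices of
    row vectors through the inverse: this matrix maps v to v \o ordS. *)
Definition shift_mx N : 'M[R[i]]_N.+1 := perm_mx (perm (@ordS_inj N.+1))^-1.

Lemma shift_unitary N : shift_mx N \is unitarymx.
Proof. by apply/unitarymxP; rewrite tr_perm_mx map_perm_mx -perm_mxM mulgV perm_mx1. Qed.

Lemma shift_mxE N (v : 'rV[R[i]]_N.+1) t (j : 'I_N.+1) :
  (v *m shift_mx N ^+ t) 0 j = v 0 (iter t (@ordS _) j).
Proof.
elim: t v j => [|t IH] v j; first by rewrite expr0 mulmx1.
by rewrite exprSr mulmxA -col_permE mxE IH permE iterSr.
Qed.

Lemma val_iter_ordS N t (j : 'I_N) : (j + t < N)%N -> iter t (@ordS _) j = (j + t)%N :> nat.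
Proof.
elim: t => [|t IH] jt; first by rewrite addn0.
rewrite iterS /= IH; last by apply: ltnW; rewrite -addnS.
by rewrite -addnS modn_small.
Qed.

(** The kernel is a polynomial in the shift.  Padding h with zeros up to a cyclic
    group longer than the reach of the averages keeps the convolution from wrapping
    around on the first L positions. *)
Lemma lacunary_kernel_L2 (lam : R) (n : nat -> nat) (w : nat -> R) N L (h : nat -> R) :
    1 < lam -> (forall k, (0 < n k)%N) ->
    (forall k, lam * (n k)%:R <= (n k.+1)%:R) -> (forall k, `|w k| <= 1) ->
  \sum_(i < L) kernel_op L (lacunary_kernel n w N) h i ^+ 2 <=
  (6 * (lam / (lam - 1)) + 1) ^+ 2 * \sum_(i < L) h i ^+ 2.
Proof.
move=> lam1 n0 nlac w1.
set A := 6 * _ + 1.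
have A0 : 0 <= A by rewrite addr_ge0 // mulr_ge0 // divr_ge0; lra.
(* a crude common bound for the lengths of the averages *)
pose B := (\sum_(k < N.+1) n k)%N.
have nB k : (k <= N)%N -> (n k <= B)%N.
  by move=> kN; rewrite /B (bigD1 (Ordinal (kN : (k < N.+1)%N))) //= leq_addr.
pose v : 'rV[R[i]]_(L + B).+1 := \row_j (if (j < L)%N then h j else 0)%:C%C.
pose q : {poly R[i]} := \sum_(k < N) (w k)%:C%C *: (avg_poly (n k.+1) - avg_poly (n k)).
have qA z : `|z| = 1 -> `|q.[z]| <= A%:C%C.
  move=> z1; have {}z1 : Normc.normc z = 1 by apply: complexI; rewrite -normcE z1 rmorph1.
  rewrite normcE lecR.
  apply: le_trans (sum_symbol_diff N lam1 n0 nlac z1).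
  rewrite horner_sum; apply: le_trans (normc_sum _ _ _) _; apply: ler_sum => k _.
  rewrite hornerZ normcM normc_real hornerD hornerN !horner_avg_poly.
  by rewrite ler_piMl ?normc_ge0.
have := von_neumann v (shift_unitary (L + B)) qA.
have -> : \sum_j `|v 0 j| ^+ 2 = (\sum_(i < L) h i ^+ 2)%:C%C.
  rewrite rmorph_sum /= -(big_mkord predT (fun i => (h i ^+ 2)%:C%C)).
  rewrite (@big_nat_widen _ _ _ 0 L (L + B).+1) ?leqW ?leq_addr //.
  rewrite big_mkord [RHS]big_mkcond; apply: eq_bigr => j _ /=.
  rewrite mxE normcE normc_real; case: ifP => _; last by rewrite normr0 expr0n.
  by rewrite -rmorphXn /= real_normK ?num_real.
rewrite -rmorphXn -rmorphM /=.
have normE (u : 'rV[R[i]]_(L + B).+1) : \sum_j `|u 0 j| ^+ 2 =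
    (\sum_(j < (L + B).+1) Normc.normc (u 0 j) ^+ 2)%:C%C.
  by rewrite rmorph_sum; apply: eq_bigr => j _; rewrite rmorphXn.
rewrite normE lecR; apply: le_trans.
rewrite -(big_mkord predT (fun i => kernel_op L (lacunary_kernel n w N) h i ^+ 2)).
rewrite (@big_nat_widen _ _ _ 0 L (L + B).+1) ?leqW ?leq_addr //.
rewrite big_mkord [leLHS]big_mkcond; apply: ler_sum => i _ /=.
case: ifP => iL; last by rewrite exprn_ge0 ?normc_ge0.
have avgE m : (m <= B)%N -> (v *m horner_mx (shift_mx (L + B)) (avg_poly m)) 0 i =
    (\sum_(j < L) average_kernel R m i j * h j)%:C%C.
  move=> mB.
  rewrite linearZ rmorph_sum /= -scalemxAr mxE mulmx_sumr summxE.
  have -> : \sum_(j < L) average_kernel R m i j * h j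
      = m%:R^-1 * \sum_(j < L) ((i < j) && (j <= i + m))%N%:R * h j.
    by rewrite mulr_sumr; apply: eq_bigr => j _; rewrite /average_kernel mulrCA mulrA.
  rewrite rmorphM /= fmorphV /= rmorph_nat; congr (_ * _).
  have term t : (t <= m)%N -> (v *m horner_mx (shift_mx (L + B)) 'X^t) 0 i =
      (if (i + t < L)%N then h (i + t)%N else 0)%:C%C.
    move=> tm; rewrite rmorphXn /= horner_mx_X shift_mxE mxE val_iter_ordS //.
    by rewrite ltnS leq_add ?(leq_trans tm) // ltnW.
  rewrite (@eq_big_nat _ _ _ 1 m.+1 _ (fun t => (if (i + t < L)%N then h (i + t)%N else 0)%:C%C)); last first.
    by move=> t /andP[_ tm]; rewrite term.
  rewrite -rmorph_sum; congr (_%:C%C).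
  rewrite -(big_mkord predT (fun j => ((i < j) && (j <= i + m))%N%:R * h j)).
  rewrite (@big_nat_widen _ _ _ 0 L (L + B).+1) ?leqW ?leq_addr // [RHS]big_mkcond /=.
  pose G j := if (j < L)%N then h j else 0.
  transitivity (\sum_(1 + i <= j < m.+1 + i) G j).
    by rewrite big_addn addnK; apply: eq_bigr => t _; rewrite /G addnC.
  rewrite (@big_nat_widen _ _ _ (1 + i) (m.+1 + i) (L + B).+1); last first.
    by rewrite addSn ltnS addnC leq_add // ltnW.
  rewrite (@big_nat_widenl _ _ _ (1 + i) 0) //= big_mkcond /=.
  apply: eq_bigr => j _; rewrite /G add1n addSn ltnS [(m + i)%N]addnC andbC.
  by case: (_ && _); case: (_ < _)%N; rewrite ?mul1r ?mul0r.
suff -> : (v *m horner_mx (shift_mx (L + B)) q) 0 i = (kernel_op L (lacunary_kernel n w N) h i)%:C%C.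
  by rewrite normc_real real_normK ?num_real.
rewrite linear_sum mulmx_sumr summxE /=.
rewrite /kernel_op /lacunary_kernel; under [in RHS]eq_bigr do rewrite mulr_suml.
rewrite exchange_big /= rmorph_sum; apply: eq_bigr => k _.
rewrite linearZ /= linearB /= -scalemxAr mulmxBr !mxE.
have -> : \sum_(j < L) w k * (average_kernel R (n k.+1) i j - average_kernel R (n k) i j) * h j =
   w k * (\sum_(j < L) average_kernel R (n k.+1) i j * h j - \sum_(j < L) average_kernel R (n k) i j * h j).
  by rewrite -sumrB mulr_sumr; apply: eq_bigr => j _; rewrite -mulrA mulrBl.
rewrite rmorphM rmorphB /= -!avgE ?nB //; last exact: ltnW.
by rewrite !mxE.
Qed.
End LacunaryL2.

(** * The Hormander condition *)
Section Hormander.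
Variable R : realType.

Lemma sum_interval (L a b : nat) : \sum_(i < L) ((a <= i) && (i < b))%N%:R <= (b - a)%N%:R :> R.
Proof.
rewrite -(big_mkord predT (fun i => ((a <= i) && (i < b))%N%:R)).
apply: (@le_trans _ _ (\sum_(0 <= i < maxn L b | (i < L)%N) ((a <= i) && (i < b))%N%:R)).
  by rewrite (@big_nat_widen _ _ _ 0 L (maxn L b)) ?leq_maxl.
apply: (@le_trans _ _ (\sum_(a <= i < b) 1)); last first.
  by rewrite big_const_nat iter_addr_0.
rewrite (@big_nat_widenl _ _ _ a 0) // (@big_nat_widen _ _ _ 0 b (maxn L b)) ?leq_maxr //=.
rewrite [leLHS]big_mkcond [leRHS]big_mkcond; apply: ler_sum => i _.
by case: ((_ <= _) && _)%N; case: (_ < L)%N.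
Qed.

Lemma far_block k i j : ~~ near_block k i j -> (j + 2 ^ k < i)%N \/ (i + 2 ^ k < j)%N.
Proof.
rewrite /near_block negb_and -!ltnNge.
have d0 : (0 < 2 ^ k)%N by rewrite expn_gt0.
have ei := divn_eq i (2 ^ k); have ej := divn_eq j (2 ^ k).
have ri := ltn_pmod i d0; have rj := ltn_pmod j d0.
by move=> /orP[] h; [left|right]; nia.
Qed.

(** Away from the block, averages of length less than 2^k vanish at both j and c,
    and longer ones differ at no more than |j - c| positions i, by 1/m each. *)
Lemma average_kernel_hormander L k m j c : (j %/ 2 ^ k = c %/ 2 ^ k)%N ->
  \sum_(i < L | ~~ near_block k i j) `|average_kernel R m i j - average_kernel R m i c| <=
  ((2 ^ k)%:R <= m%:R :> R)%R%:R * ((2 ^ k)%:R / m%:R).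
Proof.
move=> jc; set D := (2 ^ k)%N.
have d0 : (0 < D)%N by rewrite expn_gt0.
have ej := divn_eq j D; have ec := divn_eq c D; rewrite -/D in jc.
have rc := ltn_pmod c d0; have rj := ltn_pmod j d0.
have far i : ~~ near_block k i j -> `|average_kernel R m i j - average_kernel R m i c| <=
    (D <= m)%N%:R * ((minn j c - m <= i) && (i < maxn j c - m))%N%:R / m%:R.
  move=> nij.
  have nic : ~~ near_block k i c by move: nij; rewrite /near_block -/D jc.
  have fj := far_block nij; have fc := far_block nic.
  rewrite /average_kernel -mulrBl normrM [`|m%:R^-1|]ger0_norm ?invr_ge0 // ler_wpM2r ?invr_ge0 //.
  rewrite -natrM -[leLHS]/(`|_ - _|); rewrite -/D in fj fc.
  have [E1|[E1 E2]] : ((i < j) && (j <= i + m))%N = ((i < c) && (c <= i + m))%N \/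
     ((D <= m) /\ ((minn j c - m <= i) && (i < maxn j c - m)))%N.
    by rewrite jc in ej; move: fj fc ej ec rc rj; lia.
  - by rewrite E1 subrr normr0.
  - by rewrite E1 E2; do 2 case: (_ && _)%N; rewrite ?subrr ?normr0 ?subr0 ?sub0r ?normrN ?normr1.
apply: (@le_trans _ _ (\sum_(i < L | ~~ near_block k i j)
    (D <= m)%N%:R * ((minn j c - m <= i) && (i < maxn j c - m))%N%:R / m%:R)).
  by apply: ler_sum => i; exact: far.
rewrite -mulr_suml -mulr_sumr -mulrA ler_nat ler_wpM2l // ler_wpM2r ?invr_ge0 //.
apply: (@le_trans _ _ (\sum_(i < L) ((minn j c - m <= i) && (i < maxn j c - m))%N%:R)).
  by rewrite [leLHS]big_mkcond; apply: ler_sum => i _; case: ifP.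
apply: le_trans (sum_interval _ _ _) _; rewrite ler_nat.
by rewrite jc in ej; move: ej ec rc rj; lia.
Qed.

Lemma lacunary_kernel_hormander (lam : R) (n : nat -> nat) (w : nat -> R) N L k j c :
    1 < lam -> (forall k, (0 < n k)%N) ->
    (forall k, lam * (n k)%:R <= (n k.+1)%:R) -> (forall k, `|w k| <= 1) ->
    (j %/ 2 ^ k = c %/ 2 ^ k)%N ->
  \sum_(i < L | ~~ near_block k i j) `|lacunary_kernel n w N i j - lacunary_kernel n w N i c| <=
  2 * (lam / (lam - 1)).
Proof.
move=> lam1 n0 nlac w1 jc.
pose del m i := `|average_kernel R m i j - average_kernel R m i c|.
apply: (@le_trans _ _ (\sum_(i < L | ~~ near_block k i j) \sum_(l < N) (del (n l.+1) i + del (n l) i))).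
  apply: ler_sum => i _; rewrite /lacunary_kernel -sumrB.
  apply: le_trans (ler_norm_sum _ _ _) _; apply: ler_sum => l _.
  rewrite -mulrBr normrM; apply: le_trans (ler_piMl (normr_ge0 _) (w1 _)) _.
  by rewrite opprD addrACA -opprD ler_normB.
rewrite exchange_big /=.
pose x : R := (2 ^ k)%:R.
have x0 : 0 < x by rewrite ltr0n expn_gt0.
have sum_bd (m : nat -> nat) : (forall k, (0 < m k)%N) ->
    (forall k, lam * (m k)%:R <= (m k.+1)%:R) ->
    \sum_(l < N) (x <= (m l)%:R)%R%:R * (x / (m l)%:R) <= lam / (lam - 1).
  move=> m0 mlac; under eq_bigr do rewrite mulrCA.
  rewrite -mulr_sumr mulrC -ler_pdivlMr //.
  by apply: (@lacunary_sum_ge _ _ (fun k => (m k)%:R)) => // i; rewrite ltr0n m0.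
rewrite mulrDl mul1r.
apply: le_trans (lerD (sum_bd (fun k => n k.+1) _ _) (sum_bd n n0 nlac)) => //.
rewrite -big_split; apply: ler_sum => l _.
by rewrite big_split; apply: lerD; exact: average_kernel_hormander.
Qed.
End Hormander.

(** * The l^p bound for the lacunary kernel *)
Section LacunaryLp.
Variable R : realType.

Lemma conj_exponent (p : R) : 2 < p ->
  let q := p / (p - 1) in [/\ 1 < q, q < 2 & p^-1 + q^-1 = 1].
Proof.
move=> p2 q; have p1 : 0 < p - 1 by lra.
split; first by rewrite /q ltr_pdivlMr //; lra.
  by rewrite /q ltr_pdivrMr //; lra.
by rewrite /q invf_div; field; rewrite gt_eqF //; lra.
Qed.

Lemma lacunary_kernel_rev (n : nat -> nat) (w : nat -> R) N L i j : (i < L)%N -> (j < L)%N ->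
  lacunary_kernel n w N (L - i.+1) (L - j.+1) = lacunary_kernel n w N j i.
Proof.
move=> iL jL; apply: eq_bigr => k _; congr (_ * _).
have E m : average_kernel R m (L - i.+1) (L - j.+1) = average_kernel R m j i.
  have H : ((L - i.+1 < L - j.+1) && (L - j.+1 <= L - i.+1 + m) = (j < i) && (i <= j + m))%N.
    by lia.
  by rewrite /average_kernel H.
by rewrite !E.
Qed.

(** A Toeplitz matrix is conjugate to its transpose by the reflection of the
    interval. *)
Lemma lacunary_kernel_transpose n (w : nat -> R) N L (g : nat -> R) i : (i < L)%N ->
  kernel_op L (fun a b => lacunary_kernel n w N b a) g i =
  kernel_op L (lacunary_kernel n w N) (fun a => g (L - a.+1)%N) (L - i.+1).
Proof.
move=> iL; rewrite /kernel_op [RHS](reindex_inj rev_ord_inj); apply: eq_bigr => j _ /=.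
by rewrite lacunary_kernel_rev // subnSK // subKn // ltnW.
Qed.

Variables (lam p : R).
Hypotheses (lam1 : 1 < lam) (p1 : 1 < p).

Theorem lacunary_kernel_lp : exists2 C : R, 0 <= C &
  forall (n : nat -> nat) (w : nat -> R) N M (f : nat -> R), (forall k, (0 < n k)%N) ->
    (forall k, lam * (n k)%:R <= (n k.+1)%:R) -> (forall k, `|w k| <= 1) ->
  \sum_(i < 2 ^ M) `|kernel_op (2 ^ M) (lacunary_kernel n w N) f i| `^ p <=
  C * \sum_(i < 2 ^ M) `|f i| `^ p.
Proof.
pose A : R := (6 * (lam / (lam - 1)) + 1) ^+ 2.
pose B : R := 2 * (lam / (lam - 1)).
pose W := 8 * A + 4 * B + 3.
have A0 : 0 <= A by exact: sqr_ge0.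
have B0 : 0 <= B.
  by rewrite mulr_ge0 // divr_ge0 ?subr_ge0 ?(ltW lam1) // ltW // (lt_trans ltr01).
have W0 : 0 <= W by rewrite !addr_ge0 // mulr_ge0.
have lt2 (r : R) : 1 < r -> r < 2 ->
    0 <= marcinkiewicz_cst r W A /\
  forall (n : nat -> nat) (w : nat -> R) N M (f : nat -> R), (forall k, (0 < n k)%N) ->
    (forall k, lam * (n k)%:R <= (n k.+1)%:R) -> (forall k, `|w k| <= 1) ->
  \sum_(i < 2 ^ M) `|kernel_op (2 ^ M) (lacunary_kernel n w N) f i| `^ r <=
  marcinkiewicz_cst r W A * \sum_(i < 2 ^ M) `|f i| `^ r.
  move=> r1 r2; split.
    rewrite /marcinkiewicz_cst mulr_ge0 ?powR_ge0 // addr_ge0 // mulr_ge0 // divr_ge0 ?powR_ge0 //.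
      by rewrite subr_ge0 ltW // powR2_gt1 // subr_gt0.
    by rewrite subr_ge0 ltW // powR2_gt1 // subr_gt0.
  move=> n w N M f n0 nlac w1; apply: marcinkiewicz => //.
    by move=> h; exact: lacunary_kernel_L2.
  move=> h alpha al0; apply: (@weak_type _ M _ A B) => //.
    by move=> h'; exact: lacunary_kernel_L2.
  by move=> k j c _ _ _ jc; exact: lacunary_kernel_hormander.
have [p2|p2|p2] := ltgtP p 2.
- by have [? ?] := lt2 p p1 p2; exists (marcinkiewicz_cst p W A).
- have [q1 q2 pq] := conj_exponent p2; set q := p / _ in q1 q2 pq.
  have [C0 HC] := lt2 _ q1 q2.
  exists (2 * (((2 * marcinkiewicz_cst q W A + 1) `^ q^-1) `^ p)).
    by rewrite mulr_ge0 // powR_ge0.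
  move=> n w N M f n0 nlac w1; apply: (lp_duality p1 q1 pq C0) => g.
  have := HC n w N M (fun a => g (2 ^ M - a.+1)%N) n0 nlac w1.
  rewrite [X in X <= _ -> _](reindex_inj rev_ord_inj) [X in _ <= _ * X -> _](reindex_inj rev_ord_inj) /=.
  under eq_bigr => i _ do rewrite -lacunary_kernel_transpose //.
  by under [X in _ <= _ * X -> _]eq_bigr => i _ do rewrite subnSK // subKn 1?ltnW //.
- exists A => // n w N M f n0 nlac w1; rewrite p2.
  under eq_bigr do rewrite powR_mulrn // real_normK ?num_real //.
  under [X in _ <= _ * X]eq_bigr do rewrite powR_mulrn // real_normK ?num_real //.
  exact: lacunary_kernel_L2.
Qed.
End LacunaryLp.

(** * The p-th moment *)
Section Moment.
Context d (T : measurableType d) (R : realType) (mu : probability T R) (p : R).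
Hypothesis p0 : 0 < p.
Implicit Types f g h : T -> R.

(** The p-th power of the L^p norm, which is more convenient to add up. *)
Definition pmoment h : \bar R := (\int[mu]_x (`|h x| `^ p)%:E)%E.

Lemma pmoment_ge0 h : (0 <= pmoment h)%E.
Proof. by apply: integral_ge0 => x _; rewrite lee_fin powR_ge0. Qed.

Lemma Lnorm_pmoment h : Lnorm mu p%:E (EFin \o h) = (pmoment h `^ p^-1)%E.
Proof. by rewrite unlock. Qed.

Lemma Lfun_pmoment h :
  (h \in Lfun mu p%:E) <-> measurable_fun [set: T] h /\ (pmoment h < +oo)%E.
Proof.
split=> [/andP[]|[mh hoo]]; rewrite !inE /=.
  move=> mh; rewrite /finite_norm Lnorm_pmoment => hoo; split => //.
  by apply: (@lty_poweRy _ _ p^-1) => //; rewrite invr_neq0 // gt_eqF.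
apply/andP; rewrite !inE /=; split => //.
by rewrite /finite_norm Lnorm_pmoment poweR_lty.
Qed.

Lemma measurable_pmoment h : measurable_fun [set: T] h ->
  measurable_fun [set: T] (fun x => (`|h x| `^ p)%:E).
Proof.
move=> mh; apply: measurableT_comp => //.
apply: (@measurableT_comp _ _ _ _ _ _ (@powR R ^~ p)) => //.
exact: measurableT_comp.
Qed.

Lemma powR_normD_le (a b : R) : `|a + b| `^ p <= 2 `^ p * (`|a| `^ p + `|b| `^ p).
Proof.
wlog ab : a b / `|a| <= `|b|.
  move=> H; have [ab|ba] := leP `|a| `|b|; first exact: H.
  by rewrite addrC [X in _ * X]addrC; apply: H; exact: ltW.
apply: (@le_trans _ _ ((2 * `|b|) `^ p)).
  rewrite ge0_ler_powR ?nnegrE ?mulr_ge0 ?(ltW p0) //.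
  by apply: le_trans (ler_normD _ _) _; rewrite mulr2n mulrDl mul1r lerD2r.
by rewrite powRM // ler_wpM2l ?powR_ge0 // lerDr powR_ge0.
Qed.

Lemma pmomentD f g : measurable_fun [set: T] f -> measurable_fun [set: T] g ->
  (pmoment (f \+ g)%R <= (2 `^ p)%:E * (pmoment f + pmoment g))%E.
Proof.
move=> mf mg.
rewrite -ge0_integralD //; try exact: measurable_pmoment;
  try by move=> x _; rewrite lee_fin powR_ge0.
rewrite -ge0_integralZl_EFin //; last first.
- by apply: emeasurable_funD; exact: measurable_pmoment.
- by move=> x _; rewrite adde_ge0 // lee_fin powR_ge0.
apply: ge0_le_integral => //.
- by apply: measurable_pmoment; exact: measurable_funD.
- by apply: measurable_funeM; apply: emeasurable_funD; exact: measurable_pmoment.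
- by move=> x _; rewrite -EFinD -EFinM lee_fin powR_normD_le.
Qed.

End Moment.

(** * Transference from orbits to the space *)
Section Transference.
Context d (T : measurableType d) (R : realType) (mu : probability T R).
Variable tau : T -> T.
Hypothesis tau_mp : measure_preserving mu tau.
Implicit Types (f : T -> R) (w : nat -> R) (n : nat -> nat).

Lemma mp_integral (h : T -> \bar R) : measurable_fun [set: T] h ->
  (forall x, 0 <= h x)%E -> (\int[mu]_x h (tau x) = \int[mu]_x h x)%E.
Proof.
move=> mh h0; have [mtau mutau] := tau_mp.
rewrite -[LHS](@ge0_integral_pushforward _ _ _ _ _ _ mtau mu setT h) //.
apply: eq_measure_integral => A mA _; exact: mutau.
Qed.

Lemma measurable_iter i : measurable_fun [set: T] (iter i tau).
Proof.
have [mtau _] := tau_mp.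
elim: i => [|i IH]; first exact: measurable_id.
exact: (measurableT_comp mtau IH).
Qed.

Lemma mp_integral_iter (h : T -> \bar R) i : measurable_fun [set: T] h ->
  (forall x, 0 <= h x)%E -> (\int[mu]_x h (iter i tau x) = \int[mu]_x h x)%E.
Proof.
move=> mh h0; elim: i => // i <-.
under eq_integral do rewrite iterSr.
rewrite (@mp_integral (fun x => h (iter i tau x))) //.
exact: measurableT_comp (measurable_iter i).
Qed.

Definition avg_diff (n : nat -> nat) (f : T -> R) k : T -> R :=
  ergodic_average tau (n k.+1) f - ergodic_average tau (n k) f.

Definition weighted_diff (n : nat -> nat) (w : nat -> R) N f x : R :=
  \sum_(k < N) w k * avg_diff n f k x.

Lemma measurable_ergodic_average m f : measurable_fun [set: T] f ->
  measurable_fun [set: T] (ergodic_average tau m f).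
Proof.
move=> mf; apply: measurable_funM => //.
apply: measurable_sum => i; exact: measurableT_comp (measurable_iter i).
Qed.

Lemma measurable_avg_diff n f k : measurable_fun [set: T] f ->
  measurable_fun [set: T] (avg_diff n f k).
Proof. by move=> mf; apply: measurable_funB; exact: measurable_ergodic_average. Qed.

Lemma measurable_weighted_diff n w N f : measurable_fun [set: T] f ->
  measurable_fun [set: T] (weighted_diff n w N f).
Proof.
move=> mf; apply: measurable_sum => i.
by apply: measurable_funM => //; exact: measurable_avg_diff.
Qed.

Lemma ergodic_average_orbit m f L i x : (i + m < L)%N ->
  ergodic_average tau m f (iter i tau x) =
  \sum_(j < L) average_kernel R m i j * f (iter j tau x).
Proof.
move=> imL; rewrite /ergodic_average /average_kernel.
under [RHS]eq_bigr do rewrite mulrAC mulrC.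
rewrite -mulr_sumr; congr (_ * _).
transitivity (\sum_(1 + i <= j < m.+1 + i) f (iter j tau x)).
  by rewrite big_addn addnK; apply: eq_bigr => t _; rewrite iterD.
rewrite -(big_mkord predT (fun j => ((i < j) && (j <= i + m))%N%:R * f (iter j tau x))).
rewrite (@big_nat_widen _ _ _ (1 + i) (m.+1 + i) L); last by rewrite addSn addnC.
rewrite (@big_nat_widenl _ _ _ (1 + i) 0) //= big_mkcond /=.
apply: eq_bigr => j _; rewrite add1n addSn ltnS [(m + i)%N]addnC andbC.
by case: (_ && _); rewrite ?mul1r ?mul0r.
Qed.

Lemma weighted_diff_orbit n w N f L i x : (forall k, (k <= N)%N -> (i + n k < L)%N) ->
  weighted_diff n w N f (iter i tau x) =
  kernel_op L (lacunary_kernel n w N) (fun j => f (iter j tau x)) i.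
Proof.
move=> nL; rewrite /weighted_diff /kernel_op /lacunary_kernel.
under [RHS]eq_bigr do rewrite mulr_suml.
rewrite exchange_big /=; apply: eq_bigr => k _.
rewrite /avg_diff.
rewrite -[LHS]/(w k * (ergodic_average tau (n k.+1) f (iter i tau x) - ergodic_average tau (n k) f (iter i tau x))).
rewrite !(@ergodic_average_orbit _ _ L) ?nL // 1?ltnW //.
by rewrite -sumrB mulr_sumr; apply: eq_bigr => j _; rewrite -mulrA mulrBl.
Qed.
End Transference.

Lemma sume_const (R : realType) (N : nat) (X : \bar R) : (0 <= X)%E ->
  (\sum_(i < N) X = N%:R%:E * X)%E.
Proof.
move=> X0; elim: N => [|N IH]; first by rewrite big_ord0 mul0e.
by rewrite big_ord_recr /= IH -natr1 EFinD ge0_muleDl ?lee_fin // mul1e.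
Qed.

Section UniformBound.
Context d (T : measurableType d) (R : realType) (mu : probability T R).
Variable tau : T -> T.
Hypothesis tau_mp : measure_preserving mu tau.
Variables (lam p : R).
Hypotheses (lam1 : 1 < lam) (p1 : 1 < p).

(** For L = 2^M at least twice the reach B of the averages, the l^p bound on [0, L)
    applied to the orbit of x and integrated gives
    (L - B) |T_w f|_p^p <= C L |f|_p^p, and L - B >= L / 2. *)
Lemma weighted_diff_bounded : exists2 C : R, 0 <= C &
  forall (n : nat -> nat) (w : nat -> R) N (f : T -> R), (forall k, (0 < n k)%N) ->
    (forall k, lam * (n k)%:R <= (n k.+1)%:R) -> (forall k, `|w k| <= 1) ->
    measurable_fun [set: T] f ->
  (pmoment mu p (weighted_diff tau n w N f) <= C%:E * pmoment mu p f)%E.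
Proof.
have [C C0 HC] := lacunary_kernel_lp lam1 p1.
exists (2 * C) => [|n w N f n0 nlac w1 mf]; first by rewrite mulr_ge0.
(* a crude common bound for the lengths of the averages *)
pose B := (\sum_(k < N.+1) n k)%N.
have nB k : (k <= N)%N -> (n k <= B)%N.
  by move=> kN; rewrite /B (bigD1 (Ordinal (kN : (k < N.+1)%N))) //= leq_addr.
pose M := (2 * B)%N; pose L := (2 ^ M)%N.
have LB : (2 * B < L)%N by rewrite /L ltn_expl.
pose D := (L - B)%N.
set W := weighted_diff tau n w N f.
have mW : measurable_fun [set: T] W by exact: (measurable_weighted_diff tau_mp).
have mWi i : measurable_fun [set: T] (W \o iter i tau).
  by apply: measurableT_comp => //; exact: (measurable_iter tau_mp).
have mfi i : measurable_fun [set: T] (f \o iter i tau).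
  by apply: measurableT_comp => //; exact: (measurable_iter tau_mp).
have pW i : pmoment mu p (W \o iter i tau) = pmoment mu p W.
  apply: (mp_integral_iter tau_mp i (measurable_pmoment p mW)).
  by move=> x; rewrite lee_fin powR_ge0.
have pf i : pmoment mu p (f \o iter i tau) = pmoment mu p f.
  apply: (mp_integral_iter tau_mp i (measurable_pmoment p mf)).
  by move=> x; rewrite lee_fin powR_ge0.
have key : (D%:R%:E * pmoment mu p W <= (C * L%:R)%:E * pmoment mu p f)%E.
  have -> : (D%:R%:E * pmoment mu p W = \int[mu]_x \sum_(i < D) (`|W (iter i tau x)| `^ p)%:E)%E.
    rewrite ge0_integral_sum //; last by move=> i; exact: (measurable_pmoment p (mWi i)).
    rewrite (eq_bigr (fun => pmoment mu p W)) => [|i _]; last exact: pW.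
    by rewrite sume_const // pmoment_ge0.
  have -> : ((C * L%:R)%:E * pmoment mu p f =
      \int[mu]_x (C%:E * \sum_(j < L) (`|f (iter j tau x)| `^ p)%:E))%E.
    rewrite ge0_integralZl_EFin //; last 2 first.
    - by move=> x _; apply: sume_ge0 => i _; rewrite lee_fin powR_ge0.
    - by apply: emeasurable_sum => i; exact: (measurable_pmoment p (mfi i)).
    rewrite EFinM -muleA; congr (_ * _)%E.
    rewrite ge0_integral_sum //; last by move=> i; exact: (measurable_pmoment p (mfi i)).
    rewrite (eq_bigr (fun => pmoment mu p f)) => [|i _]; last exact: pf.
    by rewrite sume_const // pmoment_ge0.
  apply: ge0_le_integral => //.
  - by move=> x _; apply: sume_ge0 => i _; rewrite lee_fin powR_ge0.
  - by apply: emeasurable_sum => i; exact: (measurable_pmoment p (mWi i)).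
  - apply: measurable_funeM; apply: emeasurable_sum => i.
    exact: (measurable_pmoment p (mfi i)).
  move=> x _; rewrite !sumEFin -EFinM lee_fin.
  apply: le_trans (HC n w N M (fun j => f (iter j tau x)) n0 nlac w1).
  rewrite -(big_mkord predT (fun i => `|W (iter i tau x)| `^ p)).
  rewrite (@big_nat_widen _ _ _ 0 D L) ?leq_subr // big_mkord [leLHS]big_mkcond.
  apply: ler_sum => i _ /=; case: ifP => [iD|_]; last exact: powR_ge0.
  rewrite /W (@weighted_diff_orbit _ _ _ _ _ _ _ _ L) // => k kN.
  by apply: leq_ltn_trans (_ : i + B < L)%N; [rewrite leq_add2l nB|rewrite addnC -ltn_subRL].
have L0 : 0 < L%:R :> R by rewrite ltr0n expn_gt0.
have -> : pmoment mu p W = ((2 / L%:R)%:E * ((L%:R / 2)%:E * pmoment mu p W))%E.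
  rewrite muleA -EFinM [X in (X%:E * _)%E](_ : _ = 1) ?mul1e //.
  by field; rewrite gt_eqF.
have -> : ((2 * C)%:E * pmoment mu p f = (2 / L%:R)%:E * ((C * L%:R)%:E * pmoment mu p f))%E.
  rewrite muleA -EFinM; congr (_%:E * _)%E.
  by field; rewrite gt_eqF.
apply: lee_wpmul2l; first by rewrite lee_fin divr_ge0.
apply: le_trans key; apply: lee_wpmul2r; first exact: pmoment_ge0.
rewrite lee_fin ler_pdivrMr // -natrM ler_nat /D; lia.
Qed.
End UniformBound.

(** * Clarkson's inequality and the choice of signs *)
Lemma powR_superadd (R : realType) (r x y : R) : 1 <= r -> 0 <= x -> 0 <= y ->
  x `^ r + y `^ r <= (x + y) `^ r.
Proof.
move=> r1 x0 y0; have r0 : 0 < r by apply: lt_le_trans r1.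
rewrite -(mulr_powRB1 x0 r0) -(mulr_powRB1 y0 r0) -(mulr_powRB1 (addr_ge0 x0 y0) r0) mulrDl.
by rewrite lerD // ler_wpM2l // ge0_ler_powR ?nnegrE ?subr_ge0 ?addr_ge0 // ?lerDl ?lerDr.
Qed.

Lemma powR_midpoint (R : realType) (r x y : R) : 1 <= r -> 0 <= x -> 0 <= y ->
  (2^-1 * x + 2^-1 * y) `^ r <= 2^-1 * x `^ r + 2^-1 * y `^ r.
Proof.
move=> r1 x0 y0.
have h0 : (0 <= 2^-1 :> R) by lra. have h1 : (2^-1 <= 1 :> R) by lra.
have := @convex_powR R r r1 (Itv01 h0 h1) x y.
rewrite !inE /= !in_itv /= !andbT => /(_ x0 y0).
rewrite convRE [X in X `^ _ <= _ -> _]convRE /= /unstable.onem.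
by have -> : 1 - 2^-1 = 2^-1 :> R by lra.
Qed.

(** Superadditivity of t^(p/2) at a^2 + b^2, and its convexity at the midpoint of
    (a + b)^2 and (a - b)^2, which is the same number. *)
Lemma clarkson (R : realType) (p a b : R) : 2 <= p ->
  2 * (`|a| `^ p + `|b| `^ p) <= `|a + b| `^ p + `|a - b| `^ p.
Proof.
move=> p2.
have E (x : R) : `|x| `^ p = (x ^+ 2) `^ (p / 2).
  by rewrite -(real_normK (num_real x)) -powR_mulrn // -powRrM mulrC divfK.
have r1 : 1 <= p / 2 by rewrite ler_pdivlMr // mul1r.
rewrite !E mulrC -ler_pdivlMr //.
apply: le_trans (powR_superadd r1 (sqr_ge0 _) (sqr_ge0 _)) _.
have -> : a ^+ 2 + b ^+ 2 = 2^-1 * (a + b) ^+ 2 + 2^-1 * (a - b) ^+ 2 by field.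
apply: le_trans (powR_midpoint r1 (sqr_ge0 _) (sqr_ge0 _)) _.
by rewrite -mulrDr mulrC.
Qed.

(** Clarkson's inequality says that the property holds on average over the signs 1
    and -1. *)
Lemma pmoment_sign d (T : measurableType d) (R : realType) (mu : probability T R)
    (p : R) (f g : T -> R) : 2 <= p ->
    measurable_fun [set: T] f -> measurable_fun [set: T] g ->
  exists2 s : R, `|s| = 1 & (pmoment mu p f + pmoment mu p g <= pmoment mu p (f \+ s \*o g)%R)%E.
Proof.
move=> p2 mf mg.
have mD : measurable_fun [set: T] (f \+ g) by exact: measurable_funD.
have mB : measurable_fun [set: T] (f \- g) by exact: measurable_funB.
have H : (2%:E * (pmoment mu p f + pmoment mu p g) <= pmoment mu p (f \+ g)%R + pmoment mu p (f \- g)%R)%E.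
  rewrite -!ge0_integralD //; try exact: measurable_pmoment.
  rewrite -ge0_integralZl_EFin //; last first.
  - by apply: emeasurable_funD; exact: measurable_pmoment.
  - by move=> x _; rewrite adde_ge0 // lee_fin powR_ge0.
  apply: ge0_le_integral => //.
  - by move=> x _; rewrite mule_ge0 // adde_ge0 // lee_fin powR_ge0.
  - by apply: measurable_funeM; apply: emeasurable_funD; exact: measurable_pmoment.
  - by apply: emeasurable_funD; exact: measurable_pmoment.
  - by move=> x _; rewrite -!EFinD -EFinM lee_fin clarkson.
have E1 : (f \+ 1 \*o g)%R = (f \+ g)%R by apply/funext => x /=; rewrite mul1r.
have EN1 : (f \+ (-1) \*o g)%R = (f \- g)%R by apply/funext => x /=; rewrite mulN1r.
have [h|h] := leP (pmoment mu p f + pmoment mu p g)%E (pmoment mu p (f \+ g)%R).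
  by exists 1; rewrite ?normr1 ?E1.
exists (-1); rewrite ?normrN1 ?EN1 //.
rewrite leNgt; apply/negP => h'.
by have := lteD h h'; rewrite ltNge -mule2n -mule_natl H.
Qed.

(** * Smallness of the tails *)
Section SmallTails.
Context d (T : measurableType d) (R : realType) (mu : probability T R).
Variable tau : T -> T.
Hypothesis tau_mp : measure_preserving mu tau.
Variables (lam : R) (n : nat -> nat).
Hypotheses (lam1 : 1 < lam) (n0 : forall k, (0 < n k)%N).
Hypothesis nlac : forall k, lam * (n k)%:R <= (n k.+1)%:R.
Implicit Types (f : T -> R) (w v : nat -> R).

(** Unconditional convergence in Cauchy form, with real weights of modulus at most 1
    in place of signs. *)
Definition small_tails (p : R) f := forall e : R, 0 < e -> exists N0, forall v N,
  (forall k, `|v k| <= 1) -> (forall k, (k < N0)%N -> v k = 0) ->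
  (pmoment mu p (weighted_diff tau n v N f) <= e%:E)%E.

Lemma weighted_diff_glue w v N N' (s : R) f : (forall k, (k < N)%N -> v k = 0) ->
  weighted_diff tau n (fun k => if (k < N)%N then w k else if (k < N')%N then s * v k else 0)
    (maxn N N') f = (weighted_diff tau n w N f \+ s \*o weighted_diff tau n v N' f)%R.
Proof.
move=> v0; apply/funext => x; rewrite /weighted_diff /= mulr_sumr.
rewrite -(big_mkord predT (fun k => w k * avg_diff tau n f k x)).
rewrite (@big_nat_widen _ _ _ 0 N (maxn N N')) ?leq_maxl // big_mkord.
rewrite -(big_mkord predT (fun k => s * (v k * avg_diff tau n f k x))).
rewrite (@big_nat_widen _ _ _ 0 N' (maxn N N')) ?leq_maxr // big_mkord.
rewrite [X in _ = X + _]big_mkcond [X in _ = _ + X]big_mkcond -big_split.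
apply: eq_bigr => k _ /=; case: (ltnP k N) => kN.
  by rewrite v0 // mul0r mulr0 if_same addr0.
by case: ifP => _; rewrite add0r ?mulrA ?mul0r.
Qed.

(** If tails were not small, successive blocks of moment at least e could be glued
    with suitable signs, their moments adding up beyond the uniform bound. *)
Lemma small_tails_ge2 (p : R) f : 2 <= p -> measurable_fun [set: T] f ->
  (pmoment mu p f < +oo)%E -> small_tails p f.
Proof.
move=> p2 mf foo e e0; apply: contrapT => bad.
have p1 : 1 < p by lra.
have [C C0 HC] := weighted_diff_bounded tau_mp lam1 p1.
have step N0 : exists v N, [/\ forall k, `|v k| <= 1, forall k, (k < N0)%N -> v k = 0 &
    (e%:E < pmoment mu p (weighted_diff tau n v N f))%E].
  apply: contrapT => H; apply: bad; exists N0 => v N v1 v0.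
  by rewrite leNgt; apply/negP => h; apply: H; exists v, N; split.
have grow m : exists w N, (forall k, `|w k| <= 1) /\
    ((m%:R * e)%:E <= pmoment mu p (weighted_diff tau n w N f))%E.
  elim: m => [|m [w [N [w1 IH]]]].
    exists (fun=> 0), 0%N; split => [k|]; first by rewrite normr0.
    by rewrite mul0r pmoment_ge0.
  have [v [N' [v1 v0 h]]] := step N.
  have mw u M : measurable_fun [set: T] (weighted_diff tau n u M f).
    exact: (measurable_weighted_diff tau_mp).
  have [s s1 hs] := pmoment_sign mu p2 (mw w N) (mw v N').
  exists (fun k => if (k < N)%N then w k else if (k < N')%N then s * v k else 0), (maxn N N').
  split=> [k|].
    case: ifP => // _; case: ifP => _; last by rewrite normr0.
    by rewrite normrM s1 mul1r.
  have glue := weighted_diff_glue w N' s f v0.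
  rewrite glue; apply: le_trans hs.
  have -> : ((m.+1%:R * e)%:E = (m%:R * e)%:E + e%:E)%E.
    by rewrite -EFinD -natr1 mulrDl mul1r.
  exact: leeD IH (ltW h).
have foo' : pmoment mu p f \is a fin_num by rewrite ge0_fin_numE ?pmoment_ge0.
pose B := C * fine (pmoment mu p f).
have [m Hm] : exists m : nat, B < m%:R * e.
  exists (Num.truncn (B / e)).+1; rewrite -ltr_pdivrMr //; exact: truncnS_gt.
have [w [N [w1 h]]] := grow m.
have := le_trans h (HC n w N f n0 nlac w1 mf).
by rewrite -(fineK foo') -EFinM lee_fin leNgt Hm.
Qed.
End SmallTails.

Section Truncation.
Context d (T : measurableType d) (R : realType) (mu : probability T R) (p : R).
Hypothesis p0 : 0 < p.

Definition truncation (f : T -> R) (m : nat) x := if `|f x| <= m%:R then f x else 0.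

Lemma measurable_truncation f m : measurable_fun [set: T] f -> measurable_fun [set: T] (truncation f m).
Proof.
move=> mf; apply: measurable_fun_ifT => //.
by apply: measurable_fun_ler => //; exact: measurableT_comp.
Qed.

(** Dominated convergence: at each point the difference vanishes as soon as m exceeds
    |f x|. *)
Lemma truncation_approx f (e : R) : measurable_fun [set: T] f -> (pmoment mu p f < +oo)%E -> 0 < e ->
  exists m, (pmoment mu p (f \- truncation f m)%R <= e%:E)%E.
Proof.
move=> mf foo e0.
pose F m x := (`|(f \- truncation f m)%R x| `^ p)%:E : \bar R.
have mF m : measurable_fun [set: T] (F m).
  apply: (measurable_pmoment p); apply: measurable_funB => //.
  exact: measurable_truncation.
have cF : (\int[mu]_x F m x @[m --> \oo] --> \int[mu]_x (cst 0%E) x)%E.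
  apply: (@dominated_cvg _ _ _ mu setT measurableT F (cst 0%E) (fun x => (`|f x| `^ p)%:E)) => //.
  - move=> x _; apply: cvg_near_cst.
    near=> m; rewrite /F /= /truncation ifT ?subrr ?normr0 ?powR0 ?gt_eqF //.
    near: m; exists (Num.truncn `|f x|).+1 => // m /= mx.
    by apply: le_trans (ltW (truncnS_gt _)) _; rewrite ler_nat.
  - apply/integrableP; split; first exact: measurable_pmoment.
    by under eq_integral do rewrite gee0_abs ?lee_fin ?powR_ge0 //.
  - move=> m x _; rewrite /F /= ger0_norm ?powR_ge0 // lee_fin.
    rewrite /truncation; case: ifP => _; last by rewrite subr0.
    by rewrite subrr normr0 powR0 ?gt_eqF // powR_ge0.
rewrite integral0 in cF.
move/fine_cvgP: cF => [fF /cvgrPdist_le /(_ e e0)] => cF.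
near \oo => m; exists m.
have fm : (\int[mu]_x F m x)%E \is a fin_num by near: m; exact: fF.
have : `|0 - fine (\int[mu]_x F m x)%E| <= e by near: m; exact: cF.
rewrite sub0r normrN => h; rewrite -[pmoment _ _ _]/(\int[mu]_x F m x)%E -(fineK fm) lee_fin.
exact: le_trans (ler_norm _) h.
Unshelve. all: by end_near.
Qed.
End Truncation.

Section SmallTailsLp.
Context d (T : measurableType d) (R : realType) (mu : probability T R).
Variable tau : T -> T.
Hypothesis tau_mp : measure_preserving mu tau.
Variables (lam : R) (n : nat -> nat).
Hypotheses (lam1 : 1 < lam) (n0 : forall k, (0 < n k)%N).
Hypothesis nlac : forall k, lam * (n k)%:R <= (n k.+1)%:R.

(** Pointwise t^p <= s^p + s^(p-2) t^2, according to whether t <= s; the total mass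
    is 1. *)
Lemma pmoment_le2 (p s : R) (g : T -> R) : 0 < p -> p < 2 -> 0 < s -> measurable_fun [set: T] g ->
  (pmoment mu p g <= (s `^ p)%:E + (s `^ (p - 2))%:E * pmoment mu 2 g)%E.
Proof.
move=> p0 p2 s0 mg.
have H t : 0 <= t -> t `^ p <= s `^ p + s `^ (p - 2) * t `^ 2.
  move=> t0; have [ts|st] := leP t s.
    rewrite -[leLHS]addr0 lerD ?mulr_ge0 ?powR_ge0 //.
    by rewrite ge0_ler_powR ?nnegrE // ltW.
  have t0' : 0 < t by apply: lt_trans st.
  have -> : t `^ p = t `^ (p - 2) * t `^ 2 by rewrite -powRD ?subrK // gt_eqF // implybT.
  apply: (@le_trans _ _ (s `^ (p - 2) * t `^ 2)); last by rewrite lerDr powR_ge0.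
  rewrite ler_wpM2r ?powR_ge0 // -opprB !powRN lef_pV2 ?posrE ?powR_gt0 //.
  by rewrite ge0_ler_powR ?nnegrE ?subr_ge0 // ltW.
have m2 : measurable_fun [set: T] (fun x => (s `^ (p - 2))%:E * (`|g x| `^ 2)%:E)%E.
  by apply: measurable_funeM; exact: measurable_pmoment.
have E1 : (\int[mu]_x (s `^ p)%:E = (s `^ p)%:E)%E.
  by rewrite integral_cst //= [X in (_ * X)%E](probability_setT mu) mule1.
rewrite -[X in (_ <= X + _)%E]E1 -ge0_integralZl_EFin ?powR_ge0 //; last exact: measurable_pmoment.
have F2 x : setT x -> (0 <= (s `^ (p - 2))%:E * (`|g x| `^ 2)%:E)%E.
  by rewrite mule_ge0 // lee_fin powR_ge0.
rewrite -ge0_integralD //.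
apply: ge0_le_integral => //.
- exact: measurable_pmoment.
- by apply: emeasurable_funD.
- by move=> x _; rewrite -EFinM -EFinD lee_fin H.
- by move=> x _; rewrite lee_fin powR_ge0.
Qed.

Lemma weighted_diffD v N (f g : T -> R) :
  weighted_diff tau n v N (f \+ g)%R = (weighted_diff tau n v N f \+ weighted_diff tau n v N g)%R.
Proof.
apply/funext => x; rewrite /weighted_diff /= -big_split; apply: eq_bigr => k _ /=.
rewrite -mulrDr; congr (_ * _).
have E m : ergodic_average tau m (f \+ g)%R x = ergodic_average tau m f x + ergodic_average tau m g x.
  by rewrite /ergodic_average -mulrDr -big_split.
by rewrite /avg_diff !fctE !E opprD addrACA.
Qed.

(** For p < 2, f is the sum of a bounded function g and of a remainder h of small
    moment.  The tails of g are small in L^2, hence in L^p; those of h are bounded by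
    its moment.  The constants split e into three equal parts, up to the factor 2^p
    lost in the triangle inequality. *)
Lemma small_tails_Lp (p : R) (f : T -> R) : 1 < p -> measurable_fun [set: T] f ->
  (pmoment mu p f < +oo)%E -> small_tails mu tau n p f.
Proof.
move=> p1 mf foo; have [p2|p2] := leP 2 p; first exact: (small_tails_ge2 tau_mp lam1 n0 nlac).
move=> e e0; have p0 : 0 < p by apply: lt_trans p1.
have [C C0 HC] := weighted_diff_bounded tau_mp lam1 p1.
pose c : R := 2 `^ p; have c0 : 0 < c by rewrite powR_gt0.
pose e1 := e / (3 * c); have e10 : 0 < e1 by rewrite divr_gt0 // mulr_gt0.
have e2 : 0 < e1 / (C + 1) by rewrite divr_gt0 // ltr_wpDl.
have [m Hm] := truncation_approx p0 mf foo e2.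
pose g := truncation f m; pose h := (f \- g)%R.
have mg : measurable_fun [set: T] g by exact: measurable_truncation.
have mh : measurable_fun [set: T] h by exact: measurable_funB.
pose s := e1 `^ p^-1; have s0 : 0 < s by rewrite powR_gt0.
have sp : s `^ p = e1 by rewrite -powRrM mulVf ?gt_eqF // powRr1 // ltW.
have g2 : (pmoment mu 2 g < +oo)%E.
  apply: (@le_lt_trans _ _ (\int[mu]_x ((m%:R : R) `^ 2)%:E)%E); last first.
    by rewrite integral_cst //= [X in (_ * X)%E](probability_setT mu) mule1 ltry.
  apply: ge0_le_integral => //.
  - exact: measurable_pmoment.
  - move=> x _; rewrite lee_fin ge0_ler_powR ?nnegrE //.
    by rewrite /g /truncation; case: ifP => // _; rewrite normr0.
have e3 : 0 < e1 / s `^ (p - 2) by rewrite divr_gt0 // powR_gt0.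
have [N0 HN0] := small_tails_ge2 tau_mp lam1 n0 nlac (lexx 2) mg g2 e3.
exists N0 => v N v1 v0.
have -> : f = (g \+ h)%R by apply/funext => x; rewrite /h /= subrKC.
have mw u : measurable_fun [set: T] u -> measurable_fun [set: T] (weighted_diff tau n v N u).
  by move=> mu'; exact: (measurable_weighted_diff tau_mp).
rewrite weighted_diffD; apply: le_trans (pmomentD mu p0 (mw _ mg) (mw _ mh)) _.
rewrite -/c.
have -> : e = c * (e1 + e1 + e1) by rewrite /e1; field; rewrite gt_eqF.
rewrite EFinM lee_pmul2l ?lte_fin // EFinD leeD //.
  apply: le_trans (pmoment_le2 p0 p2 s0 (mw _ mg)) _.
  rewrite sp EFinD leeD // -lee_pdivlMl ?powR_gt0 //.
  by rewrite -EFinM mulrC; exact: HN0.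
apply: le_trans (HC n v N h n0 nlac v1 mh) _.
apply: le_trans (lee_wpmul2l _ Hm) _; first by rewrite lee_fin.
rewrite -EFinM lee_fin mulrCA ler_piMr ?(ltW e10) // ler_pdivrMr ?ltr_wpDl // mul1r lerDl.
done.
Qed.
End SmallTailsLp.

(** * Completeness of L^p *)
Lemma le_limn_einf_powR (R : realType) (p l : R) (u : nat -> R) : 0 < p ->
  (forall j, 0 <= u j) -> u @ \oo --> l ->
  ((l `^ p)%:E <= limn_einf (fun j => (u j `^ p)%:E))%E.
Proof.
move=> p0 u0 ul.
have l0 : 0 <= l.
  rewrite -(cvg_lim (@Rhausdorff R) ul); apply: limr_ge; first exact: cvgP ul.
  exact: nearW.
move: l0; rewrite le_eqVlt => /predU1P[<-|l0].
  rewrite powR0 ?gt_eqF // limn_einf_lim; apply: lime_ge; first exact: is_cvg_einfs.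
  by apply: nearW => k; apply: le_ereal_inf_tmp => _ [m _ <-]; rewrite lee_fin powR_ge0.
rewrite (cvg_limn_einf_sup (l := (l `^ p)%:E) _).1 //.
apply: cvg_EFin; first exact: nearW.
have powE : {near \oo, (fun j => expR (p * ln (u j))) =1 (fun j => u j `^ p)}.
  near=> j; rewrite /powR gt_eqF //; near: j; exact: (cvgr_gt l ul).
apply: cvg_trans (near_eq_cvg powE) _.
rewrite {1}/powR gt_eqF //.
apply: continuous_cvg; first exact: continuous_expR.
apply: cvgMr; apply: continuous_cvg => //; exact: continuous_ln.
Unshelve. all: by end_near.
Qed.

Lemma geometric_cauchy_cvg (R : realType) (t : nat -> R) (c : R) :
  (forall j, `|t j.+1 - t j| <= c * 2^-1 ^+ j) -> cvgn t.
Proof.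
move=> tc.
have c0 : 0 <= c by have := tc 0%N; rewrite expr0 mulr1; apply: le_trans.
have -> : t = (fun j => t 0%N + series (telescope t) j).
  by apply/funext => j; rewrite -eq_sum_telescope.
apply: is_cvgD; first exact: is_cvg_cst.
apply: normed_cvg; apply: (@series_le_cvg _ _ (geometric c 2^-1)) => //.
- by move=> j; exact: normr_ge0.
- by move=> j; rewrite /= mulr_ge0 // exprn_ge0.
- by apply: is_cvg_geometric_series; rewrite ger0_norm //; lra.
Qed.

Section RieszFischer.
Context d (T : measurableType d) (R : realType) (mu : probability T R) (p : R).
Hypothesis p0 : 0 < p.
Variable t : nat -> T -> R.
Hypothesis mt : forall j, measurable_fun [set: T] (t j).
Hypothesis t_fast : forall j,
  (pmoment mu p (t j.+1 \- t j)%R <= (2^-1 ^+ j * (2^-1 ^+ j) `^ p)%:E)%E.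

(** The series of the (2^j |t_(j+1) - t_j|)^p has a finite integral, so it is finite
    almost everywhere, and then |t_(j+1) - t_j| decreases geometrically. *)
Lemma fast_cauchy_ae_cvg : {ae mu, forall x, cvgn (t ^~ x)}.
Proof.
pose a j x := (2 ^+ j * `|t j.+1 x - t j x|) `^ p.
have a0 j x : (0 <= (a j x)%:E)%E by rewrite lee_fin powR_ge0.
have ma j : measurable_fun [set: T] (fun x => (a j x)%:E).
  have := @measurable_pmoment _ T R p (fun x => 2 ^+ j * (t j.+1 x - t j x)) _.
  rewrite (_ : (fun x => (`|2 ^+ j * (t j.+1 x - t j x)| `^ p)%:E) = (fun x => (a j x)%:E)).
    by apply; apply: measurable_funM => //; exact: measurable_funB.
  by apply/funext => x; rewrite /a normrM [`|2 ^+ j|]ger0_norm ?exprn_ge0.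
have inta j : (\int[mu]_x (a j x)%:E <= (2^-1 ^+ j)%:E)%E.
  have -> : (\int[mu]_x (a j x)%:E = ((2 ^+ j) `^ p)%:E * pmoment mu p (t j.+1 \- t j)%R)%E.
    rewrite -ge0_integralZl_EFin ?powR_ge0 //; last first.
      by apply: measurable_pmoment; exact: measurable_funB.
    by apply: eq_integral => x _; rewrite /a powRM ?exprn_ge0.
  apply: le_trans (lee_wpmul2l _ (t_fast j)) _; first by rewrite lee_fin powR_ge0.
  rewrite -EFinM lee_fin mulrCA -powRM ?exprn_ge0 ?invr_ge0 //.
  by rewrite -exprMn mulfV // expr1n powR1 mulr1.
pose H x := (\sum_(j <oo) (a j x)%:E)%E.
have mH : measurable_fun [set: T] H by apply: ge0_emeasurable_sum.
have intH : (\int[mu]_x H x <= 2%:E)%E.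
  rewrite integral_nneseries //; apply: lime_le.
    by apply: is_cvg_nneseries => j _ _; apply: integral_ge0.
  apply: nearW => m; apply: (@le_trans _ _ (\sum_(0 <= j < m) (2^-1 ^+ j)%:E)%E).
    by apply: lee_sum => j _.
  rewrite sumEFin lee_fin.
  suff -> : \sum_(0 <= j < m) (2^-1 ^+ j) = 2 - 2 * 2^-1 ^+ m :> R.
    by rewrite lerBlDr lerDl mulr_ge0 // exprn_ge0.
  elim: m => [|m IH]; first by rewrite big_geq // expr0 mulr1 subrr.
  by rewrite big_nat_recr //= IH exprS; field.
have iH : mu.-integrable setT H.
  apply/integrableP; split => //.
  under eq_integral do rewrite gee0_abs ?nneseries_ge0 //.
  exact: le_lt_trans intH (ltry _).
have := integrable_ae measurableT iH.
apply: filterS => x /(_ I) Hx.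
apply: (@geometric_cauchy_cvg _ _ (fine (H x) `^ p^-1)) => j.
have aH : a j x <= fine (H x).
  rewrite -lee_fin fineK //.
  apply: le_trans (@nneseries_lim_ge _ (fun j => (a j x)%:E) xpredT 0 j.+1 _) => //.
  rewrite big_nat_recr //= leeDr // sume_ge0 //.
have : 2 ^+ j * `|t j.+1 x - t j x| <= fine (H x) `^ p^-1.
  have -> : 2 ^+ j * `|t j.+1 x - t j x| = a j x `^ p^-1.
    by rewrite /a -powRrM mulfV ?gt_eqF // powRr1 // mulr_ge0 // exprn_ge0.
  rewrite ge0_ler_powR ?nnegrE ?powR_ge0 ?invr_ge0 ?(ltW p0) //.
  exact: le_trans (powR_ge0 _ _) aH.
by rewrite mulrC exprVn ler_pdivlMr ?exprn_gt0.
Qed.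

(** The limit superior serves as a measurable choice of a limit at every point. *)
Definition fast_limit x : R := fine (limn_esup (fun j => (t j x)%:E)).

Lemma measurable_fast_limit : measurable_fun [set: T] fast_limit.
Proof.
apply: measurableT_comp => //.
by apply: measurable_fun_limn_esup => j; exact: measurableT_comp.
Qed.

Lemma fast_limit_cvg x : cvgn (t ^~ x) -> t ^~ x @ \oo --> fast_limit x.
Proof.
move=> /cvg_ex[l tl]; rewrite /fast_limit.
rewrite (cvg_limn_einf_sup (l := l%:E) _).2 //.
by apply: cvg_EFin => //; exact: nearW.
Qed.

Lemma measurable_limn_einf (F : nat -> T -> \bar R) :
  (forall j, measurable_fun [set: T] (F j)) ->
  measurable_fun [set: T] (fun x => limn_einf (F ^~ x)).
Proof.
move=> mF.
rewrite (_ : (fun x => _) = (fun x => - limn_esup (fun j => - F j x))%E).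
  apply: measurableT_comp => //; apply: measurable_fun_limn_esup => j.
  exact: measurableT_comp.
apply/funext => x; rewrite -limn_einfN; congr limn_einf.
by apply/funext => j /=; rewrite oppeK.
Qed.

(** Fatou's lemma. *)
Lemma fast_limit_pmoment (h : T -> R) (e : \bar R) N : measurable_fun [set: T] h ->
  (forall j, (N <= j)%N -> (pmoment mu p (h \- t j)%R <= e)%E) ->
  (pmoment mu p (h \- fast_limit)%R <= e)%E.
Proof.
move=> mh he.
pose F j x := (`|h x - t j x| `^ p)%:E : \bar R.
have mF j : measurable_fun [set: T] (F j).
  by apply: (measurable_pmoment p); exact: measurable_funB.
apply: (@le_trans _ _ (\int[mu]_x limn_einf (F ^~ x))%E).
  apply: ae_ge0_le_integral => //.
  - by apply: measurable_pmoment; apply: measurable_funB => //; exact: measurable_fast_limit.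
  - move=> x _; rewrite limn_einf_lim; apply: lime_ge; first exact: is_cvg_einfs.
    by apply: nearW => k; apply: le_ereal_inf_tmp => _ [m _ <-]; rewrite lee_fin powR_ge0.
  - exact: measurable_limn_einf.
  apply: filterS fast_cauchy_ae_cvg => x /fast_limit_cvg tx _.
  apply: le_limn_einf_powR => //; apply: cvg_norm; apply: cvgB => //; exact: cvg_cst.
apply: le_trans (fatou mu measurableT mF _) _.
  by move=> j x _; rewrite lee_fin powR_ge0.
rewrite limn_einf_lim; apply: lime_le; first exact: is_cvg_einfs.
near=> j; apply: le_trans (he j _); last by near: j; exact: nbhs_infty_ge.
by apply: ereal_inf_lbound; exists j => /=.
Unshelve. all: by end_near.
Qed.
End RieszFischer.

(** A subsequence with fast decreasing differences has a limit almost everywhere,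
    and the whole sequence converges to it in L^p. *)
Lemma Lp_convergent_cauchy d (T : measurableType d) (R : realType) (mu : probability T R)
    (p : R) (s : nat -> T -> R) : 0 < p -> (forall N, s N \in Lfun mu p%:E) ->
  (forall e : R, 0 < e -> exists N0, forall M N, (N0 <= M)%N -> (M <= N)%N ->
     (pmoment mu p (s N \- s M)%R <= e%:E)%E) ->
  Lp_convergent mu p s.
Proof.
move=> p0 sL sC.
have ms N : measurable_fun [set: T] (s N) by have /(Lfun_pmoment mu p0)[] := sL N.
have fs N : (pmoment mu p (s N) < +oo)%E by have /(Lfun_pmoment mu p0)[] := sL N.
have eps0 j : 0 < 2^-1 ^+ j * (2^-1 ^+ j) `^ p :> R.
  by rewrite mulr_gt0 ?powR_gt0 // exprn_gt0 // invr_gt0.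
have [K HK] := choice (fun j => sC _ (eps0 j)).
(* strictly increasing indices beyond which the j-th Cauchy bound holds *)
pose phi j := (\sum_(i < j.+1) (K i).+1)%N.
have phiS j : phi j.+1 = (phi j + (K j.+1).+1)%N by rewrite /phi big_ord_recr.
have phi_K j : (K j <= phi j)%N by rewrite /phi big_ord_recr /= ltnW // ltn_addl.
have phi_j j : (j <= phi j)%N by elim: j => // j IH; rewrite phiS; lia.
pose t j := s (phi j).
have mt j : measurable_fun [set: T] (t j) by exact: ms.
have t_fast j : (pmoment mu p (t j.+1 \- t j)%R <= (2^-1 ^+ j * (2^-1 ^+ j) `^ p)%:E)%E.
  by apply: HK => //; rewrite phiS leq_addr.
pose g := fast_limit t.
have mg : measurable_fun [set: T] g by exact: measurable_fast_limit.
have symm (a b : T -> R) : pmoment mu p (a \- b)%R = pmoment mu p (b \- a)%R.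
  by apply: eq_integral => x _ /=; rewrite distrC.
have close (e : R) : 0 < e -> exists N0, forall N, (N0 <= N)%N -> (pmoment mu p (s N \- g)%R <= e%:E)%E.
  move=> e0; have [N0 HN0] := sC e e0; exists N0 => N NN0.
  apply: (fast_limit_pmoment p0 mt t_fast (ms N) (N := N0)) => j jN0.
  have [h|h] := leqP (phi j) N; first by apply: HN0 => //; exact: leq_trans (phi_j j).
  by rewrite symm; apply: HN0 => //; exact: ltnW.
exists g.
  apply/(Lfun_pmoment mu p0); split => //.
  have [N HN] := close 1 ltr01.
  have -> : g = (s N \+ (g \- s N))%R by apply/funext => x /=; rewrite subrKC.
  apply: le_lt_trans (pmomentD mu p0 (ms N) (measurable_funB mg (ms N))) _.
  rewrite lte_mul_pinfty ?lee_fin ?powR_ge0 // lte_add_pinfty // symm.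
  exact: le_lt_trans (HN N (leqnn _)) (ltry _).
have small (e : R) : 0 < e -> exists N0, forall N, (N0 <= N)%N ->
    (Lnorm mu p%:E (EFin \o (s N - g)%R) <= e%:E)%E.
  move=> e0; have [N0 HN0] := close (e `^ p) (powR_gt0 _ e0); exists N0 => N NN0.
  rewrite Lnorm_pmoment.
  have -> : e%:E = ((e `^ p)%:E `^ p^-1)%E.
    by rewrite poweR_EFin -powRrM mulfV ?gt_eqF // powRr1 // ltW.
  apply: gt0_ler_poweR.
  - by rewrite invr_ge0 ltW.
  - by rewrite in_itv /= pmoment_ge0 leey.
  - by rewrite in_itv /= lee_fin powR_ge0 leey.
  - exact: HN0.
apply/fine_cvgP; split.
  have [N0 HN0] := small 1 ltr01; exists N0 => // N /= NN0.
  by rewrite ge0_fin_numE; [exact: le_lt_trans (HN0 N NN0) (ltry _)|exact: Lnorm_ge0].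
apply/cvgrPdist_le => e e0; have [N0 HN0] := small e e0; exists N0 => // N /= NN0.
rewrite sub0r normrN /= ger0_norm ?fine_ge0 ?Lnorm_ge0 //.
have fN : Lnorm mu p%:E (EFin \o (s N - g)%R) \is a fin_num.
  by rewrite ge0_fin_numE; [exact: le_lt_trans (HN0 N NN0) (ltry _)|exact: Lnorm_ge0].
by rewrite -lee_fin fineK // HN0.
Qed.

(** * Permuted series *)

(** The terms with indices M to N - 1 of the permuted series are those whose original
    index k has its new position sigma k in this range. *)
Lemma series_permuted d (T : measurableType d) (R : realType) (tau : T -> T) (n : nat -> nat)
    (f : T -> R) (pi sigma : nat -> nat) (M N : nat) :
  cancel pi sigma -> cancel sigma pi -> (M <= N)%N ->
  (series (avg_diff tau n f \o pi) N \- series (avg_diff tau n f \o pi) M)%R =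
  weighted_diff tau n (fun k => (M <= sigma k < N)%N%:R) (\max_(i < N) pi i).+1 f.
Proof.
move=> piK sigK MN; apply/funext => x.
have -> : (series (avg_diff tau n f \o pi) N \- series (avg_diff tau n f \o pi) M)%R x
    = \sum_(M <= i < N) avg_diff tau n f (pi i) x.
  rewrite /series /= (big_cat_nat _ MN) //= !fctE addrAC subrr add0r.
  by rewrite fct_sumE.
rewrite /weighted_diff.
transitivity (\sum_(M <= i < N) \sum_(k < (\max_(i < N) pi i).+1)
    (i == sigma k)%:R * avg_diff tau n f k x).
  rewrite !big_nat; apply: eq_bigr => i /andP[_ iN].
  have piB : (pi i < (\max_(i < N) pi i).+1)%N.
    by rewrite ltnS; exact: (@leq_bigmax _ (fun i : 'I_N => pi i) (Ordinal iN)).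
  rewrite (bigD1 (Ordinal piB)) //= piK eqxx mul1r big1 ?addr0 // => k ki.
  rewrite (_ : (i == sigma k) = false) ?mul0r //; apply/eqP => ik.
  by case/eqP: ki; apply: val_inj; rewrite /= ik sigK.
rewrite exchange_big; apply: eq_bigr => k _ /=; rewrite -mulr_suml; congr (_ * _).
have [/andP[Mk kN]|h] := boolP (M <= sigma k < N)%N.
  rewrite (bigD1_seq (sigma k)) ?mem_index_iota ?Mk ?iota_uniq //= eqxx big1 ?addr0 // => i /negbTE -> //.
rewrite big_nat big1 // => i iMN; case: eqP => // ik; by rewrite -ik iMN in h.
Qed.


Unset Implicit Arguments.

Theorem theorem6p2 (R : realType) (n : nat -> nat)
    (n_gt0 : forall k : nat, (0 < n k)%N) (n_lac : lacunary R n)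
    (d : measure_display) (T : measurableType d) (mu : probability T R)
    (tau : T -> T) (tau_mp : measure_preserving mu tau)
    (p : R) (p_gt1 : 1 < p) (f : T -> R) (f_Lp : f \in Lfun mu p%:E) :
  Lp_unconditionally_convergent mu p
    (fun k : nat => ergodic_average tau (n k.+1) f - ergodic_average tau (n k) f).
Proof.
have p0 : 0 < p by apply: lt_trans p_gt1.
have [lam lam1 lamn] := n_lac.
have nlac k : lam * (n k)%:R <= (n k.+1)%:R by rewrite -ler_pdivlMr ?ltr0n.
have /(Lfun_pmoment mu p0)[mf foo] := f_Lp.
have uL k : avg_diff tau n f k \in Lfun mu p%:E.
  apply/(Lfun_pmoment mu p0); split; first exact: (measurable_avg_diff tau_mp).
  have [C C0 HC] := weighted_diff_bounded tau_mp lam1 p_gt1.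
  have -> : avg_diff tau n f k = weighted_diff tau n (fun l => (l == k)%:R) k.+1 f.
    apply/funext => x; rewrite /weighted_diff big_ord_recr /= eqxx mul1r big1 ?add0r // => i _.
    by rewrite ltn_eqF // mul0r.
  apply: le_lt_trans (HC n _ k.+1 f n_gt0 nlac _ mf) _.
    by move=> l; rewrite normr_nat; case: eqP.
  by rewrite lte_mul_pinfty ?lee_fin.
split=> // pi [sigma piK sigK].
apply: Lp_convergent_cauchy => //.
  have p1E : (1 <= p%:E)%E by rewrite lee_fin ltW.
  have [L0 LD] := Lfun_addr_closed mu p1E.
  by move=> N; rewrite /series /=; elim/big_ind: _ => // i _; exact: uL.
move=> e e0.
have [K HK] := small_tails_Lp tau_mp lam1 n_gt0 nlac p_gt1 mf foo e0.
exists (\max_(k < K) sigma k).+1 => M N MK MN.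
rewrite (series_permuted _ _ _ piK sigK MN); apply: HK => [k|k kK].
  by rewrite normr_nat; case: (_ && _).
rewrite leqNgt (leq_ltn_trans _ MK) //.
exact: (@leq_bigmax _ (fun i : 'I_K => sigma i) (Ordinal kK)).
Qed.
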